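(* Let $w$ be a weight vector for $H_A(\beta)$ and let $\beta_0\in\mathbb{C}$ be a fixed homogenizing value for $A$, $\beta$ and $w$. For any basic Nilsson solution $\phi=x^v\sum_{u\in C}x^up_u(\log(x))$ of $H_A(\beta)$ in the direction of $w$, the formal series \[ \rho(\phi)=\sum_{u\in C}\partial_0^{|u|}\bigl[x_0^{\beta_0-|v|}x^{v+u}\widehat{p_u}(\log x_0,\log x_1,\dots,\log x_n)\bigr] \] is a basic Nilsson solution of $H_{\rho(A)}(\beta_0,\beta)$ in the direction of $(0,w)$. Consequently, extending $\rho$ linearly from a basis of $\mathscr{N}_w(H_A(\beta))$ consisting of basic Nilsson solutions gives a linear map \[ \rho:\mathscr{N}_w(H_A(\beta))\to\mathscr{N}_{(0,w)}(H_{\rho(A)}(\beta_0,\beta)). \]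
   Context: Hypergeometric systems. $\mathbb{N}=\{0,1,2,\dots\}$. $A=[a_{ij}]\in\mathbb{Z}^{d\times n}$ is a matrix whose columns $a_1,\dots,a_n$ generate $\mathbb{Z}^d$ as a group, and $\beta\in\mathbb{C}^d$. $D$ is the complex Weyl algebra in $x_1,\dots,x_n,\partial_1,\dots,\partial_n$; $I_A=\langle \partial^u-\partial^v\mid u,v\in\mathbb{N}^n,\ Au=Av\rangle\subseteq\mathbb{C}[\partial_1,\dots,\partial_n]$; $E_i=\sum_{j}a_{ij}x_j\partial_j$; $H_A(\beta)=D\cdot I_A+\langle E_1-\beta_1,\dots,E_d-\beta_d\rangle$ is a left $D$-ideal. $\ker_{\mathbb{Z}}(A)=\{u\in\mathbb{Z}^n: Au=0\}$, and $|u|$ is the sum of the coordinates of $u$. Weight vectors. For $w\in\mathbb{R}^n$, the $(-w,w)$-weight of $x^u\partial^v$ is $-w\cdot u+w\cdot v$; the initial form of a nonzero $f\in D$ is the sum of its terms of maximal weight; $\mathrm{in}_{(-w,w)}(J)$ is the left ideal generated by the initial forms of nonzero elements of a left ideal $J$. Similarly $\mathrm{in}_w(J)$ for an ideal $J\subseteq\mathbb{C}[\partial]$, where $\partial^v$ has weight $w\cdot v$. A vector $w\in\mathbb{R}^n_{>0}$ is a weight vector for $H_A(\beta)$ if there is a strongly convex open rational polyhedral cone $\mathscr{C}\subset\mathbb{R}^n_{>0}$ containing $w$ such that for all $w'\in\mathscr{C}$: $\mathrm{in}_w(I_A)=\mathrm{in}_{w'}(I_A)$ and $\mathrm{in}_{(-w,w)}(H_A(\beta))=\mathrm{in}_{(-w',w')}(H_A(\beta))$.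 Then $\mathrm{in}_w(I_A)$ is a monomial ideal. When $(1,\dots,1)$ lies in the rational row span of the matrix, the positivity requirements are dropped. $\mathscr{C}^*=\{u\in\mathbb{R}^n: u\cdot w'\ge 0\ \forall w'\in\mathscr{C}\}$. Nilsson series. With $\log(x)=(\log x_1,\dots,\log x_n)$, a basic Nilsson solution of $H_A(\beta)$ in the direction of $w$ is a formal solution of $H_A(\beta)$ of the form $\phi=\sum_{u\in C}x^{v+u}p_u(\log(x))$, with $v\in\mathbb{C}^n$, such that: (1) $C\subseteq\mathscr{C}^*\cap\ker_{\mathbb{Z}}(A)$ for some strongly convex open rational polyhedral cone $\mathscr{C}\ni w$ (contained in $\mathbb{R}^n_{>0}$ unless $(1,\dots,1)$ lies in the rational row span of the matrix) such that $\mathrm{in}_w(I_A)=\mathrm{in}_{w'}(I_A)$ and $\mathrm{in}_{(-w,w)}(H_A(\beta))=\mathrm{in}_{(-w',w')}(H_A(\beta))$ for all $w'\in\mathscr{C}$; (2) the $p_u$ are polynomials with degrees bounded by a common integer $K$; (3) $p_0\neq0$. $\mathscr{N}_w(H_A(\beta))$ is the $\mathbb{C}$-span of the basic Nilsson solutions in the direction of $w$. The polynomials $p_u$ of a basic Nilsson solution automatically lie in the symmetric algebra of $\ker_{\mathbb{Z}}(A)$, i.e. they are polynomials in the linear forms $t\mapsto\gamma\cdot t$, $\gamma\in\ker_{\mathbb{Z}}(A)$. A fake exponent of $H_A(\beta)$ with respect to $w$ is $v\in\mathbb{C}^n$ such that $x^v$ is a solution of the left ideal $\mathrm{in}_w(I_A)+\langle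 E_1-\beta_1,\dots,E_d-\beta_d\rangle$ of $D$. Homogenization. $\rho(A)\in\mathbb{Z}^{(d+1)\times(n+1)}$ is obtained from $A$ by attaching a column of zeros on the left and then a top row of ones; its columns, and the corresponding variables $x_0,\dots,x_n$, are indexed by $0,1,\dots,n$. All notions above apply to $\rho(A)$, $(\beta_0,\beta)$, $(0,w)$. $\beta_0\in\mathbb{C}$ is a homogenizing value for $A,\beta,w$ if $\beta_0\notin\mathbb{Z}$ and $\beta_0-|v|\notin\mathbb{Z}$ for every fake exponent $v$ of $H_A(\beta)$ with respect to $w$. Standing assumption: $(0,w)$ is a weight vector for $H_{\rho(A)}(\beta_0,\beta)$. For $p$ in the symmetric algebra of $\ker_{\mathbb{Z}}(A)$ write $p(t_1,\dots,t_n)=\sum_\alpha c_\alpha\prod_{j=1}^{n-d}(\gamma_j\cdot(t_1,\dots,t_n))^{\alpha_j}$ with $\{\gamma_j\}$ a $\mathbb{Z}$-basis of $\ker_{\mathbb{Z}}(A)$, and set $\widehat p(t_0,\dots,t_n)=\sum_\alpha c_\alpha\prod_{j}(-|\gamma_j|t_0+\gamma_j\cdot(t_1,\dots,t_n))^{\alpha_j}$. For $s_0\notin\mathbb{Z}$, $s\in\mathbb{C}^n$ and a polynomial $\hat p$, $\partial_0^{-1}[x_0^{s_0}x^s\hat p(\log x_0,\dots,\log x_n)]$ denotes the unique expression $x_0^{s_0+1}x^s\hat q(\log x_0,\dots,\log x_n)$, $\hat q$ a polynomial, whose $\partial_0$-derivative is $x_0^{s_0}x^s\hat p(\log x_0,\dots,\log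 x_n)$; iterate to define $\partial_0^{-k}$ for $k>0$. *)

(* Defs.v *)
From HB Require Import structures.
From mathcomp Require Import all_boot all_order all_algebra.
From mathcomp Require Import boolp classical_sets functions fsbigop reals.
From mathcomp Require Import complex ssrcomplements mpoly.

Set Implicit Arguments.
Unset Strict Implicit.
Unset Printing Implicit Defensive.

Import Order.TTheory GRing.Theory Num.Theory.
Local Open Scope classical_set_scope.
Local Open Scope ring_scope.

(** * Left ideals, spans and bases *)

Definition left_ideal (T : nzRingType) (J : set T) : Prop :=
  [/\ J 0, forall x y, J x -> J y -> J (x + y) & forall a x, J x -> J (a * x)].

Definition ideal_gen (T : nzRingType) (S : set T) : set T :=
  smallest (@left_ideal T) S.

Definition lspan (K : nzRingType) (V : lmodType K) (S : set V) : set V :=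
  [set x | exists (k : nat) (c : 'I_k -> K) (f : 'I_k -> V),
     (forall i, S (f i)) /\ x = \sum_(i < k) c i *: f i].

Definition is_basis (K : nzRingType) (V : lmodType K) (U : set V)
    (I : choiceType) (f : I -> V) : Prop :=
  lspan (range f) = U /\
  forall (s : seq I) (c : I -> K), uniq s ->
    \sum_(i <- s) c i *: f i = 0 -> forall i, i \in s -> c i = 0.

Definition linear_on (K : nzRingType) (V V' : lmodType K) (U : set V)
    (T : V -> V') : Prop :=
  forall c x y, U x -> U y -> T (c *: x + y) = c *: T x + T y.

(** * The Weyl algebra

    An operator [\sum c_(a,b) x^a \partial^b] is stored as its normally ordered
    symbol: a polynomial in [n + n] variables, of which the first [n] stand for
    the [x_i] and the last [n] for the [\partial_i]. *)

Definition weyl (K : comNzRingType) (n : nat) : Type := {mpoly K[n + n]}.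

HB.instance Definition _ (K : comNzRingType) (n : nat) :=
  GRing.Lmodule.copy (weyl K n) {mpoly K[n + n]}.

Definition xdeg (n : nat) (m : 'X_{1..n + n}) : 'X_{1..n} :=
  [multinom m (lshift n i) | i < n].

Definition ddeg (n : nat) (m : 'X_{1..n + n}) : 'X_{1..n} :=
  [multinom m (rshift n i) | i < n].

(* [T_1^(m_1) ... T_n^(m_n) x] *)
Definition monop (n : nat) (V : Type) (T : 'I_n -> V -> V) (m : 'X_{1..n})
    (x : V) : V :=
  foldr (fun i => iter (m i) (T i)) x (enum 'I_n).

(* [\sum c_(a,b) x^a \partial^b] acting on [V], given the actions [X i] of [x_i]
   and [Y i] of [\partial_i] *)
Definition wact (K : comNzRingType) (n : nat) (V : lmodType K)
    (X Y : 'I_n -> V -> V) (f : weyl K n) (v : V) : V :=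
  \sum_(m <- msupp f) f@_m *: monop X (xdeg m) (monop Y (ddeg m) v).

(* On symbols, left multiplication by [x_i] is multiplication by the variable,
   and [\partial_i \cdot (c(x) \partial^b)
         = c(x) \partial_i \partial^b + (dc/dx_i)(x) \partial^b]. *)
Definition symX (K : comNzRingType) (n : nat) (i : 'I_n) (g : {mpoly K[n + n]})
    : {mpoly K[n + n]} := 'X_(lshift n i) * g.

Definition symD (K : comNzRingType) (n : nat) (i : 'I_n) (g : {mpoly K[n + n]})
    : {mpoly K[n + n]} := 'X_(rshift n i) * g + mderiv (lshift n i) g.

Definition weyl_mul (K : comNzRingType) (n : nat) (f g : weyl K n) : weyl K n :=
  wact (@symX K n) (@symD K n) f g.

Record weyl_rel (K : comNzRingType) (n : nat) (V : lmodType K)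
    (X Y : 'I_n -> V -> V) : Prop := WeylRel {
  wr_linX : forall i, linear (X i);
  wr_linY : forall i, linear (Y i);
  wr_XX : forall i j v, X i (X j v) = X j (X i v);
  wr_YY : forall i j v, Y i (Y j v) = Y j (Y i v);
  wr_YX : forall i j v, Y i (X j v) = X j (Y i v) + (i == j)%:R *: v }.

Section Monop.
Variables (n : nat) (V : Type) (T : 'I_n -> V -> V).
Hypothesis TT : forall i j v, T i (T j v) = T j (T i v).

Lemma iter_comm i j k v : T i (iter k (T j) v) = iter k (T j) (T i v).
Proof. by elim: k => //= k IH; rewrite TT IH. Qed.

Lemma monop_comm i m v : T i (monop T m v) = monop T m (T i v).
Proof. by rewrite /monop; elim: (enum _) => //= j s <-; rewrite iter_comm. Qed.

Lemma monop0 v : monop T 0%MM v = v.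
Proof. by rewrite /monop; elim: (enum _) => //= j s ->; rewrite mnm0E. Qed.

Lemma monopU i m v : monop T (m + U_(i))%MM v = T i (monop T m v).
Proof.
rewrite /monop; move: (enum_uniq 'I_n) (mem_enum 'I_n i).
elim: (enum _) => //= j s IH /andP[js us]; rewrite inE mnmDE mnm1E.
have [ij _|ij /= si] := eqVneq i j; last by rewrite addn0 IH // iter_comm.
subst j; rewrite addn1 iterS; congr (T i (iter _ _ _)).
elim: s js {IH us} => //= k s IH; rewrite inE negb_or => /andP[ik /IH ->].
by rewrite mnmDE mnm1E (negbTE ik) addn0.
Qed.

End Monop.

Lemma monop_morph (n : nat) (V W : Type) (T : 'I_n -> V -> V)
    (T' : 'I_n -> W -> W) (h : V -> W) (m : 'X_{1..n}) v :
  (forall i x, h (T i x) = T' i (h x)) -> h (monop T m v) = monop T' m (h v).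
Proof.
move=> hT; rewrite /monop; elim: (enum _) => //= i s <-.
by elim: (m i) => //= k <-; rewrite hT.
Qed.

Lemma monop_linear (K : nzRingType) (n : nat) (V : lmodType K)
    (T : 'I_n -> V -> V) (m : 'X_{1..n}) :
  (forall i, linear (T i)) -> linear (monop T m).
Proof.
move=> linT c x y; rewrite /monop; elim: (enum _) => //= i s ->.
by elim: (m i) => //= k ->; rewrite linT.
Qed.

Section PlainLinear.
Variables (K : nzRingType) (U W : lmodType K) (h : U -> W).
Hypothesis lh : linear h.

Lemma plinD : {morph h : x y / x + y}.
Proof. by move=> x y; have := lh 1 x y; rewrite !scale1r. Qed.

Lemma plin0 : h 0 = 0.
Proof. by apply: (addrI (h 0)); rewrite -plinD !addr0. Qed.

Lemma plinZ c : {morph h : x / c *: x}.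
Proof. by move=> x; have := lh c x 0; rewrite plin0 !addr0. Qed.

Lemma plin_sum I (r : seq I) (c : I -> K) (x : I -> U) :
  h (\sum_(i <- r) c i *: x i) = \sum_(i <- r) c i *: h (x i).
Proof.
by elim: r => [|i r IH]; rewrite ?big_nil ?plin0 // !big_cons lh IH.
Qed.

End PlainLinear.

Section Wact.
Variables (K : comNzRingType) (n : nat) (V : lmodType K).
Variables (X Y : 'I_n -> V -> V).
Implicit Types (f g : weyl K n) (v : V).

Lemma wact_linearl v : linear (fun f : weyl K n => wact X Y f v).
Proof.
pose F m := monop X (xdeg m) (monop Y (ddeg m) v).
have E k (f : {mpoly K[n + n]}) : (msize f <= k)%N ->
    wact X Y f v = \sum_(m : 'X_{1..(n + n)%N < k}) f@_m *: F m.
  pose I : subFinType _ := 'X_{1..(n + n)%N < k}.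
  move=> fk; rewrite /wact (big_mksub I) /=; first last.
    by move=> x /msize_mdeg_lt/leq_trans/(_ fk).
    by rewrite msupp_uniq.
  by rewrite big_rmcond //= => j /memN_msupp_eq0 ->; rewrite scale0r.
move=> c f g; pose k := maxn (msize (c *: (f : {mpoly K[n + n]}) + g))
  (maxn (msize (f : {mpoly K[n + n]})) (msize (g : {mpoly K[n + n]}))).
have [k1 k2 k3] : [/\ (msize (c *: (f : {mpoly K[n + n]}) + g) <= k)%N,
    (msize (f : {mpoly K[n + n]}) <= k)%N
    & (msize (g : {mpoly K[n + n]}) <= k)%N].
  by rewrite /k !leq_max !leqnn !orbT.
rewrite (E k _ k1) (E k _ k2) (E k _ k3) scaler_sumr -big_split /=.
by apply: eq_bigr => m _; rewrite mcoeffD mcoeffZ scalerA scalerDl.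
Qed.

Lemma wactX m v :
  wact X Y ('X_[m] : {mpoly K[n + n]}) v
  = monop X (xdeg m) (monop Y (ddeg m) v).
Proof. by rewrite /wact msuppX big_seq1 mcoeffX eqxx scale1r. Qed.

Hypothesis XY : weyl_rel X Y.

Let linX := wr_linX XY.
Let linY := wr_linY XY.
Let XX := wr_XX XY.
Let YY := wr_YY XY.

Lemma wact_linearr f : linear (wact X Y f).
Proof.
move=> c x y; rewrite /wact scaler_sumr -big_split /=; apply: eq_bigr => m _.
by rewrite !monop_linear // scalerDr !scalerA mulrC.
Qed.

Lemma Y_iterX i j k v :
  Y i (iter k (X j) v)
  = iter k (X j) (Y i v) + ((i == j) * k)%:R *: iter k.-1 (X j) v.
Proof.
elim: k => [|k IH] /=; first by rewrite muln0 scale0r addr0.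
rewrite (wr_YX XY) IH (plinD (linX j)) (plinZ (linX j)) -addrA; congr (_ + _).
case: k {IH} => [|k] /=; first by rewrite muln0 muln1 scale0r add0r.
by rewrite -scalerDl -natrD [in RHS]mulnS addnC.
Qed.

Lemma Y_monopX i m v :
  Y i (monop X m v)
  = monop X m (Y i v) + (m i)%:R *: monop X (m - U_(i))%MM v.
Proof.
rewrite /monop; suff: forall s, uniq s -> Y i (foldr (fun i => iter (m i) (X i)) v s) =
    foldr (fun i => iter (m i) (X i)) (Y i v) s + ((i \in s) * m i)%:R *:
    foldr (fun j => iter ((m - U_(i))%MM j) (X j)) v s.
  by move=> /(_ _ (enum_uniq 'I_n)) ->; rewrite mem_enum mul1n.
have itl k j : linear (iter k (X j)).
  by move=> c x y; elim: k => //= k ->; rewrite linX.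
elim=> /= [_|j s IH /andP[js us]]; first by rewrite mul0n scale0r addr0.
rewrite Y_iterX IH // (plinD (itl _ _)) (plinZ (itl _ _)) -addrA.
congr (_ + _).
rewrite mnmBE mnm1E inE; have [ij|ij] := eqVneq i j; last first.
  by rewrite mul0n scale0r addr0 subn0.
subst j; rewrite (negbTE js) mul0n scale0r add0r !mul1n subn1.
congr (_ *: iter _ _ _); elim: s js {IH us} => //= k s IH.
rewrite inE negb_or => /andP[ik /IH ->].
by rewrite mnmBE mnm1E (negbTE ik) subn0.
Qed.

Lemma wact_symX i g v : wact X Y (symX i g) v = X i (wact X Y g v).
Proof.
pose L (g : weyl K n) := wact X Y (symX i g) v.
have lL : linear L.
  by move=> c x y; rewrite /L /symX mulrDr -scalerAr; exact: wact_linearl.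
rewrite -/(L g) [g in LHS]mpolyE plin_sum // /wact plin_sum //.
apply: eq_bigr => m _; congr (_ *: _).
rewrite /L /symX -mpolyXD wactX addmC.
have -> : xdeg (m + U_(lshift n i)) = (xdeg m + U_(i))%MM.
  apply/mnmP => j; rewrite !(mnmDE, mnmE) eq_lshift.
  by [].
have -> : ddeg (m + U_(lshift n i)) = ddeg m.
  by apply/mnmP => j; rewrite !(mnmDE, mnmE) eq_lrshift addn0.
by rewrite monopU.
Qed.

Lemma wact_symD i g v : wact X Y (symD i g) v = Y i (wact X Y g v).
Proof.
pose L (g : weyl K n) := wact X Y (symD i g) v.
have lL : linear L.
  move=> c x y; rewrite /L /symD mulrDr -scalerAr mderivD mderivZ.
  rewrite addrACA -scalerDr; exact: wact_linearl.
rewrite -/(L g) [g in LHS]mpolyE plin_sum // /wact plin_sum //.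
apply: eq_bigr => m _; congr (_ *: _).
rewrite /L /symD -mpolyXD mderivX (plinD (wact_linearl v)).
rewrite (plinZ (wact_linearl v)) !wactX [(U_(_) + m)%MM]addmC.
have -> : xdeg (m + U_(rshift n i)) = xdeg m.
  by apply/mnmP => j; rewrite !(mnmDE, mnmE) eq_rlshift addn0.
have -> : ddeg (m + U_(rshift n i)) = (ddeg m + U_(i))%MM.
  by apply/mnmP => j; rewrite !(mnmDE, mnmE) eq_rshift.
have -> : xdeg (m - U_(lshift n i)) = (xdeg m - U_(i))%MM.
  by apply/mnmP => j; rewrite !(mnmBE, mnmE) eq_lshift.
have -> : ddeg (m - U_(lshift n i)) = ddeg m.
  by apply/mnmP => j; rewrite !(mnmBE, mnmE) eq_lrshift subn0.
by rewrite monopU // Y_monopX mnmE.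
Qed.

Lemma wactM f g v : wact X Y (weyl_mul f g) v = wact X Y f (wact X Y g v).
Proof.
rewrite /weyl_mul [wact (@symX _ _) _ _ _]/wact (plin_sum (wact_linearl v)) [RHS]/wact.
apply: eq_bigr => m _; congr (_ *: _).
rewrite (@monop_morph _ _ _ _ X (fun g => wact X Y g v)); last first.
  by move=> j x; rewrite wact_symX.
rewrite (@monop_morph _ _ _ _ Y (fun g => wact X Y g v)) // => j x.
by rewrite wact_symD.
Qed.

Lemma wact1 v : wact X Y (1 : {mpoly K[n + n]}) v = v.
Proof.
rewrite -mpolyX0 wactX; have E0 : xdeg (n := n) 0%MM = 0%MM.
  by apply/mnmP => i; rewrite !mnmE.
have -> : ddeg (n := n) 0%MM = 0%MM by apply/mnmP => i; rewrite !mnmE.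
by rewrite E0 !monop0.
Qed.

End Wact.

Lemma sym_weyl_rel (K : comNzRingType) (n : nat) :
  weyl_rel (@symX K n) (@symD K n).
Proof.
split.
- by move=> i c x y; rewrite /symX mulrDr scalerAr.
- move=> i c x y; rewrite /symD mulrDr mderivD mderivZ -scalerAr scalerDr.
  by rewrite addrACA.
- by move=> i j v; rewrite /symX mulrCA.
- move=> i j v; rewrite /symD !(mderivD, mderivM, mulrDr) !mderivX !mnm1E.
  by rewrite !eq_rlshift !scale0r !mul0r !add0r mulrCA addrACA mderiv_comm
    [_ + 'X_(rshift n j) * _]addrC addrACA.
- move=> i j v; rewrite /symD /symX mderivM mderivX mnm1E eq_lshift mulrDr.
  rewrite mulrCA -!addrA; congr (_ + _); rewrite addrC; congr (_ + _).
  have [->|] := eqVneq i j; last by rewrite !scale0r mul0r.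
  suff -> : (U_(lshift n j) - U_(lshift n j))%MM = 0%MM :> 'X_{1..(n + n)}.
    by rewrite mpolyX0 -scalerAl mul1r.
  by apply/mnmP => k; rewrite mnmBE mnm0E subnn.
Qed.

Lemma monop_symX (K : comNzRingType) (n : nat) (m : 'X_{1..n}) g :
  monop (@symX K n) m g = \prod_(i < n) 'X_(lshift n i) ^+ m i * g.
Proof.
rewrite /monop -big_enum /=; elim: (enum _) => [|i s IH] /=.
  by rewrite big_nil mul1r.
rewrite big_cons IH; elim: (m i) => [|k /= ->]; first by rewrite mul1r.
by rewrite /symX exprS !mulrA.
Qed.

Section WeylRing.
Variables (K : comNzRingType) (n : nat).

Let one : weyl K n := (1 : {mpoly K[n + n]}).

Lemma weyl_mulA : associative (@weyl_mul K n).
Proof.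
by move=> f g h; rewrite [RHS]/weyl_mul wactM //; apply: sym_weyl_rel.
Qed.

Lemma weyl_mul1 : left_id one (@weyl_mul K n).
Proof. by move=> f; apply: wact1. Qed.

Lemma weyl_1mul : right_id one (@weyl_mul K n).
Proof.
move=> f; rewrite [RHS](mpolyE f); apply: eq_bigr => m _; congr (_ *: _).
rewrite monop_symX [in RHS]mpolyXE_id big_split_ord /=; congr (_ * _).
  by apply: eq_bigr => i _; rewrite mnmE.
pose P s := \prod_(i <- s) 'X_(rshift n i) ^+ m (rshift n i) : {mpoly K[n + n]}.
have dX i j k (q : {mpoly K[n + n]}) : mderiv (lshift n i) q = 0 ->
    mderiv (lshift n i) ('X_(rshift n j) ^+ k * q) = 0.
  move=> q0; elim: k => [|k IH]; first by rewrite mul1r.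
  by rewrite exprS -mulrA mderivM IH mulr0 addr0 mderivX mnm1E eq_rlshift
    scale0r mul0r.
have dP i s : mderiv (lshift n i) (P s) = 0.
  elim: s => [|j s IH]; first by rewrite /P big_nil -mpolyC1 mderivC.
  by rewrite /P big_cons dX.
rewrite /monop -big_enum -/(P _) /=; elim: (enum _) => [|i s IH] /=.
  by rewrite /P big_nil.
rewrite IH {2}/P big_cons -/(P s) mnmE.
elim: (m _) => [|k /= ->]; first by rewrite mul1r.
by rewrite /symD dX // addr0 exprS mulrA.
Qed.

Lemma weyl_mulDl : left_distributive (@weyl_mul K n) +%R.
Proof. by move=> f g h; rewrite /weyl_mul (plinD (wact_linearl _ _ h)). Qed.

Lemma weyl_mulDr : right_distributive (@weyl_mul K n) +%R.
Proof.
by move=> f g h; rewrite /weyl_mul (plinD (wact_linearr (sym_weyl_rel _ _) f)).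
Qed.

Lemma weyl_1neq0 : one != 0.
Proof. exact: (oner_neq0 {mpoly K[n + n]}). Qed.

HB.instance Definition _ := GRing.Zmodule_isNzRing.Build (weyl K n)
  weyl_mulA weyl_mul1 weyl_1mul weyl_mulDl weyl_mulDr weyl_1neq0.

Definition wX (i : 'I_n) : weyl K n := 'X_(lshift n i).
Definition wD (i : 'I_n) : weyl K n := 'X_(rshift n i).

End WeylRing.

(** * Formal series [\sum_s x^s p_s(log x)]

    The monomials [x^s log(x)^a], [s \in K^n], are taken to be linearly
    independent, so a formal series is the function [s |-> p_s]. *)

Definition logseries (K : comNzRingType) (n : nat) : Type :=
  'cV[K]_n -> {mpoly K[n]}.

HB.instance Definition _ (K : comNzRingType) (n : nat) :=
  GRing.Lmodule.copy (logseries K n) ('cV[K]_n -> {mpoly K[n]}).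

(* [x^s p(log x)] *)
Definition lterm (K : comNzRingType) (n : nat) (s : 'cV[K]_n) (p : {mpoly K[n]})
    : logseries K n := fun s' => if s' == s then p else 0.

Definition unitv (K : comNzRingType) (n : nat) (i : 'I_n) : 'cV[K]_n :=
  delta_mx i 0.

Definition xmul (K : comNzRingType) (n : nat) (i : 'I_n) (phi : logseries K n)
    : logseries K n := fun s => phi (s - unitv K i).

(* [\partial_i (x^s p(log x)) = x^(s - e_i) (s_i p + dp/dt_i)(log x)] *)
Definition ddx (K : comNzRingType) (n : nat) (i : 'I_n) (phi : logseries K n)
    : logseries K n :=
  fun s => let s' := s + unitv K i in s' i 0 *: phi s' + mderiv i (phi s').

Definition lact (K : comNzRingType) (n : nat) : weyl K n -> logseries K n ->
    logseries K n := wact (@xmul K n) (@ddx K n).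

Definition solution (K : comNzRingType) (n : nat) (J : set (weyl K n))
    (phi : logseries K n) : Prop := forall P, J P -> lact P phi = 0.

(* The pointwise sums are over finite supports whenever the single terms have
   pairwise distinct exponents, as in all uses below. *)
Definition formal_sum (K : comNzRingType) (n m : nat) (C : set 'cV[int]_n)
    (F : 'cV[int]_n -> logseries K m) : logseries K m :=
  fun s => \sum_(u \in C) F u s.

Section LogseriesModule.
Variables (K : comNzRingType) (n : nat).
Implicit Types (i j : 'I_n) (s : 'cV[K]_n) (p : {mpoly K[n]}) (phi : logseries K n).

Lemma unitvE i j : unitv K i j 0 = (i == j)%:R.
Proof. by rewrite mxE eqxx andbT eq_sym. Qed.

Lemma series_weyl_rel : weyl_rel (@xmul K n) (@ddx K n).
Proof.
split.
- by move=> i c x y; apply/funext => s.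
- move=> i c x y; apply/funext => s; rewrite /ddx /=.
  set s' := s + _; rewrite -[RHS]/(c *: (s' i 0 *: x s' + mderiv i (x s')) +
    (s' i 0 *: y s' + mderiv i (y s'))).
  rewrite -[(c *: x + y) s']/(c *: x s' + y s') mderivD mderivZ !scalerDr.
  by rewrite !scalerA mulrC addrACA.
- by move=> i j phi; apply/funext => s; rewrite /xmul addrAC.
- move=> i j phi; have [->//|ij] := eqVneq i j; apply/funext => s.
  rewrite /ddx /= [s + unitv K j + _]addrAC; set t := _ + unitv K j.
  have -> : (s + unitv K i) i 0 = t i 0.
    by rewrite /t [RHS]mxE unitvE eq_sym (negbTE ij) addr0.
  have -> : (s + unitv K j) j 0 = t j 0.
    by rewrite /t addrAC [RHS]mxE unitvE (negbTE ij) addr0.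
  rewrite !mderivD !mderivZ !scalerDr !scalerA mderiv_comm.
  by rewrite [t i 0 * _]mulrC -!addrA; congr (_ + _); rewrite addrCA.
- move=> i j phi; apply/funext => s.
  rewrite -[RHS]/(ddx i phi (s - unitv K j) + (i == j)%:R *: phi s).
  rewrite /ddx /xmul [s - unitv K j + _]addrAC.
  have -> : (s + unitv K i - unitv K j) i 0
      = (s + unitv K i) i 0 - (i == j)%:R.
    by rewrite mxE [in X in _ + X]mxE unitvE eq_sym.
  have [->|_] := eqVneq i j; last by rewrite subr0 scale0r addr0.
  by rewrite addrK scalerBl scale1r addrAC subrK.
Qed.

Lemma lactM P Q phi : lact (P * Q) phi = lact P (lact Q phi).
Proof. exact: wactM series_weyl_rel P Q phi. Qed.

Lemma ddx_lterm i s p :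
  ddx i (lterm s p) = lterm (s - unitv K i) (s i 0 *: p + mderiv i p).
Proof.
apply/funext => s'; rewrite /ddx /lterm -[s' == _]subr_eq0 opprB addrA.
rewrite subr_eq0; case: eqVneq => [->|_] //.
by rewrite scaler0 add0r mderiv0.
Qed.

End LogseriesModule.

(** * Hypergeometric systems *)

Definition csum (K : nmodType) (n : nat) (v : 'cV[K]_n) : K :=
  \sum_(i < n) v i 0.

Definition intv (K : nzRingType) (n : nat) (u : 'cV[int]_n) : 'cV[K]_n :=
  map_mx intr u.

Definition mnmv (n : nat) (m : 'X_{1..n}) : 'cV[int]_n :=
  \col_i (m i : int).

Definition columns_generate (d n : nat) (A : 'M[int]_(d, n)) : Prop :=
  forall y : 'cV[int]_d, exists u : 'cV[int]_n, A *m u = y.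

Definition ker_int (d n : nat) (A : 'M[int]_(d, n)) : set 'cV[int]_n :=
  [set u | A *m u = 0].

Section Hypergeometric.
Variables (K : comNzRingType) (d n : nat).
Implicit Types (A : 'M[int]_(d, n)) (beta : 'cV[K]_d).

(* [K[\partial_1, ..., \partial_n]] is [{mpoly K[n]}] *)
Definition toric_ideal A : set {mpoly K[n]} :=
  ideal_gen [set f | exists u v : 'X_{1..n},
    A *m mnmv u = A *m mnmv v /\ f = 'X_[u] - 'X_[v]].

Definition diffop (f : {mpoly K[n]}) : weyl K n :=
  \sum_(m <- msupp f) f@_m *: \prod_(i < n) wD K i ^+ m i.

Definition euler A (i : 'I_d) : weyl K n :=
  \sum_(j < n) (A i j)%:~R *: (wX K j * wD K j).

(* [D I + <E_1 - beta_1, ..., E_d - beta_d>] *)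
Definition euler_ideal A beta (I : set {mpoly K[n]}) : set (weyl K n) :=
  ideal_gen (diffop @` I `|`
    [set euler A i - (beta i 0 *: (1 : weyl K n) : weyl K n) | i in [set: 'I_d]]).

Definition hypergeometric A beta : set (weyl K n) :=
  euler_ideal A beta (toric_ideal A).

End Hypergeometric.

Arguments toric_ideal K {d n} A.

(** * Weights, initial ideals and weight vectors *)

Definition initial_form (R : realType) (K : nzRingType) (N : nat)
    (wt : 'X_{1..N} -> R) (f : {mpoly K[N]}) : {mpoly K[N]} :=
  \sum_(m <- msupp f | all (fun m' => wt m' <= wt m) (msupp f)) f@_m *: 'X_[m].

(* weight of [\partial^m] *)
Definition wtD (R : realType) (n : nat) (w : 'cV[R]_n) (m : 'X_{1..n}) : R :=
  \sum_(i < n) w i 0 * (m i)%:R.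

(* [(-w, w)]-weight of [x^u \partial^v] *)
Definition wtW (R : realType) (n : nat) (w : 'cV[R]_n) (m : 'X_{1..(n + n)%N})
    : R := - wtD w (xdeg m) + wtD w (ddeg m).

Definition in_w (R : realType) (K : comNzRingType) (n : nat) (w : 'cV[R]_n)
    (I : set {mpoly K[n]}) : set {mpoly K[n]} :=
  ideal_gen [set initial_form (wtD w) f | f in [set f | I f /\ f != 0]].

Definition in_ww (R : realType) (K : comNzRingType) (n : nat) (w : 'cV[R]_n)
    (J : set (weyl K n)) : set (weyl K n) :=
  ideal_gen [set (initial_form (wtW w) f : weyl K n)
              | f in [set f | J f /\ f != 0]].

Definition dotv (R : nzRingType) (n : nat) (u v : 'cV[R]_n) : R :=
  \sum_(i < n) u i 0 * v i 0.

(* The rows of [B] define the closed rational cone [{w | B w >= 0}] and the open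
   cone [{w | B w > 0}]; when nonempty, the latter is the interior of the former
   and has it as closure, so strong convexity is stated on the closed cone. *)
Definition sc_open_rational_cone (R : realType) (n : nat) (C : set 'cV[R]_n)
    : Prop :=
  exists (k : nat) (B : 'M[rat]_(k, n)),
    let Bmul (w : 'cV[R]_n) : 'cV[R]_k := map_mx ratr B *m w in
    C = [set w | forall i, 0 < Bmul w i 0] /\
    forall w, (forall i, 0 <= Bmul w i 0) -> (forall i, 0 <= Bmul (- w) i 0) ->
      w = 0.

Definition dual_cone (R : realType) (n : nat) (C : set 'cV[R]_n)
    : set 'cV[R]_n := [set u | forall w, C w -> 0 <= dotv u w].

Definition ones_in_rowspan (d n : nat) (A : 'M[int]_(d, n)) : Prop :=
  exists c : 'rV[rat]_d, c *m map_mx intr A = const_mx 1.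

Section WeightVectors.
Variables (R : realType) (d n : nat).
Implicit Types (A : 'M[int]_(d, n)) (beta : 'cV[R[i]]_d) (w : 'cV[R]_n).

Definition weight_cone A beta w (C : set 'cV[R]_n) : Prop :=
  [/\ sc_open_rational_cone C, C w,
      ones_in_rowspan A \/ (forall w', C w' -> forall i, 0 < w' i 0) &
      forall w', C w' ->
        in_w w (toric_ideal R[i] A) = in_w w' (toric_ideal R[i] A) /\
        in_ww w (hypergeometric A beta) = in_ww w' (hypergeometric A beta)].

Definition weight_vector A beta w : Prop := exists C, weight_cone A beta w C.

Definition fake_exponent A beta w (v : 'cV[R[i]]_n) : Prop :=
  solution (euler_ideal A beta (in_w w (toric_ideal R[i] A))) (lterm v 1).

(** * Nilsson series *)

(* [\sum_(u in C) x^(v + u) p_u(log x)] *)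
Definition nilsson_series (v : 'cV[R[i]]_n) (C : set 'cV[int]_n)
    (p : 'cV[int]_n -> {mpoly R[i][n]}) : logseries R[i] n :=
  formal_sum C (fun u => lterm (v + intv R[i] u) (p u)).

Definition basic_nilsson A beta w v C p : Prop :=
  [/\ solution (hypergeometric A beta) (nilsson_series v C p),
      exists2 W, weight_cone A beta w W &
        C `<=` [set u | ker_int A u /\ dual_cone W (intv R u)],
      exists k : nat, forall u, C u -> (msize (p u) <= k.+1)%N &
      C 0 /\ p 0 != 0].

Definition is_basic_nilsson A beta w (phi : logseries R[i] n) : Prop :=
  exists v C p, basic_nilsson A beta w v C p /\ phi = nilsson_series v C p.

Definition nilsson_space A beta w : set (logseries R[i] n) :=
  lspan (is_basic_nilsson A beta w).

End WeightVectors.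

(** * Homogenization *)

Definition is_integer (K : nzRingType) (z : K) : Prop :=
  exists k : int, z = k%:~R.

Definition homogenizing_value (R : realType) (d n : nat) (A : 'M[int]_(d, n))
    (beta : 'cV[R[i]]_d) (w : 'cV[R]_n) (beta0 : R[i]) : Prop :=
  ~ is_integer beta0 /\
  forall v, fake_exponent A beta w v -> ~ is_integer (beta0 - csum v).

(* The variable [x_0] has index [ord0 : 'I_(1 + n)]. *)
Definition consv (T : Type) (n : nat) (a : T) (v : 'cV[T]_n) : 'cV[T]_(1 + n) :=
  col_mx (const_mx a) v.

Definition rho_mx (d n : nat) (A : 'M[int]_(d, n)) : 'M[int]_(1 + d, 1 + n) :=
  block_mx (const_mx 1) (const_mx 1) 0 A.

(* [a . t] *)
Definition linform (K : comNzRingType) (n : nat) (a : 'cV[int]_n)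
    : {mpoly K[n]} := \sum_(i < n) (a i 0)%:~R *: 'X_i.

(* the columns of [G] form a [Z]-basis of [ker_Z(A)] *)
Definition ker_basis (d n m : nat) (A : 'M[int]_(d, n)) (G : 'M[int]_(n, m))
    : Prop :=
  A *m G = 0 /\
  forall u, ker_int A u -> exists! c : 'cV[int]_m, u = G *m c.

(* [p = \sum_a c_a \prod_j (g_j . t)^(a_j)] and
   [ph = \sum_a c_a \prod_j (- |g_j| t_0 + g_j . t)^(a_j)],
   with [q = \sum_a c_a 'X_[a]] *)
Definition hat_rel (K : comNzRingType) (d n : nat) (A : 'M[int]_(d, n))
    (p : {mpoly K[n]}) (ph : {mpoly K[1 + n]}) : Prop :=
  exists (G : 'M[int]_(n, n - d)) (q : {mpoly K[n - d]}),
    [/\ ker_basis A G,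
        p = q \mPo [tuple linform K (col j G) | j < n - d] &
        ph = q \mPo
          [tuple linform K (consv (- csum (col j G)) (col j G)) | j < n - d]].

(* [\widehat p]; junk unless [p] is in the symmetric algebra of [ker_Z(A)] *)
Definition hat (K : comNzRingType) (d n : nat) (A : 'M[int]_(d, n))
    (p : {mpoly K[n]}) : {mpoly K[1 + n]} := xget 0 (hat_rel A p).

(* [\partial_0^{-1}] of [x^s p(log x)], as the exponent and the polynomial of the
   resulting term *)
Definition antideriv0 (K : comNzRingType) (n : nat)
    (sp : 'cV[K]_(1 + n) * {mpoly K[1 + n]}) :
    'cV[K]_(1 + n) * {mpoly K[1 + n]} :=
  let s' := sp.1 + unitv K ord0 in
  (s', xget 0 [set q | ddx ord0 (lterm s' q) = lterm sp.1 sp.2]).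

(* [\partial_0^k] of [x^s p(log x)] *)
Definition ddx0_pow (K : comNzRingType) (n : nat) (k : int)
    (s : 'cV[K]_(1 + n)) (p : {mpoly K[1 + n]}) : logseries K (1 + n) :=
  match k with
  | Posz k => iter k (ddx ord0) (lterm s p)
  | Negz k => let sp := iter k.+1 (@antideriv0 K n) (s, p) in lterm sp.1 sp.2
  end.

Definition rho_series (R : realType) (d n : nat) (A : 'M[int]_(d, n))
    (beta0 : R[i]) (v : 'cV[R[i]]_n) (C : set 'cV[int]_n)
    (p : 'cV[int]_n -> {mpoly R[i][n]}) : logseries R[i] (1 + n) :=
  formal_sum C (fun u =>
    ddx0_pow (csum u) (consv (beta0 - csum v) (v + intv R[i] u))
      (hat A (p u))).

(* bases of the Nilsson space made of basic Nilsson solutions, each given with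
   an expansion, on which [rho] depends *)
Definition nilsson_basis (R : realType) (d n : nat) (A : 'M[int]_(d, n))
    (beta : 'cV[R[i]]_d) (w : 'cV[R]_n) (I : choiceType) (v : I -> 'cV[R[i]]_n)
    (C : I -> set 'cV[int]_n) (p : I -> 'cV[int]_n -> {mpoly R[i][n]}) : Prop :=
  (forall i, basic_nilsson A beta w (v i) (C i) (p i)) /\
  is_basis (nilsson_space A beta w)
    (fun i => nilsson_series (v i) (C i) (p i)).

(* Main.v *)
(** In the coefficients [phi(s)] of [x^s] everything becomes pointwise. On
    polynomials in [log x] the hat is the substitution [t_j |-> t_j - t_0], which
    makes sense for every polynomial, commutes with the [d/dt_j], [j > 0], and
    kills [\sum_j d/dt_j]. On exponents outside [Z], [\partial_0] acts on
    coefficients by the invertible operators [c + d/dt_0]. Hence [rho] extends to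
    operators [R_m = \sum_u \partial_0^(|u| + m) x_0^(beta0 - |v|) (hat of the
    term u)] on all series, with [\partial_0 R_m = R_(m+1)] and
    [\partial_j R_m = R_(m+1) \partial_j], so that
    [\partial^a R_0 = R_|a| \partial^a'] for [a = (a_0, a')]: as [rho(A) a]
    determines both [|a|] and [A a'], the toric equations of [phi] pass to
    [rho(phi)], and the Euler equations hold term by term.

    That [beta0 - |v|] is not an integer holds because [v] is a fake exponent: the
    dual cone meets [w^\perp] only in [0], so the initial form of [phi] is
    [x^v p_0(log x)], and a monomial [\partial^m] killing it also kills [x^v]. *)

Require Import Defs.
From HB Require Import structures.
From mathcomp Require Import all_boot all_order all_algebra.
From mathcomp Require Import boolp classical_sets functions fsbigop reals.
From mathcomp Require Import complex ssrcomplements mpoly zify ring.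

Set Implicit Arguments.
Unset Strict Implicit.
Unset Printing Implicit Defensive.

Import Order.TTheory GRing.Theory Num.Theory.
Local Open Scope classical_set_scope.
Local Open Scope ring_scope.

(** * Polynomials and the hat substitution *)

Lemma mnm_ind (n : nat) (P : 'X_{1..n} -> Prop) :
  P 0%MM -> (forall m i, P m -> P (m + U_(i))%MM) -> forall m, P m.
Proof.
move=> P0 PU m; move: {2}(mdeg m) (erefl (mdeg m)) => k.
elim: k m => [|k IH] m mk.
  by move/eqP: mk; rewrite mdeg_eq0 => /eqP ->.
have [i mi] : exists i, m i != 0%N.
  apply/existsP; apply: contraT => /existsPn m0.
  move: mk; suff -> : m = 0%MM by rewrite mdeg0.
  by apply/mnmP => i; rewrite mnm0E; apply/eqP; rewrite -[_ == _]negbK m0.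
have mE : m = (m - U_(i) + U_(i))%MM by rewrite submK // lep1mP.
rewrite mE; apply/PU/IH; apply/eqP; rewrite -eqSS -mk.
by rewrite [in X in _ == X]mE mdegD mdeg1 addn1.
Qed.

(** The variables generate the polynomial ring as an algebra, so identities about substitutions and
    actions need checking only for multiplication by one variable. *)
Lemma mpoly_alg_ind (K : comNzRingType) (n : nat) (P : {mpoly K[n]} -> Prop) :
  P 1 -> (forall p q, P p -> P q -> P (p + q)) ->
  (forall c p, P p -> P (c *: p)) -> (forall i p, P p -> P ('X_i * p)) ->
  forall p, P p.
Proof.
move=> P1 PD PZ PX; elim/mpolyind => [|c m p _ _ Pp].
  by rewrite -(scale0r 1); apply: PZ.
apply: PD => //; apply: PZ; elim/mnm_ind: m => [|m i Pm].
  by rewrite mpolyX0.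
by rewrite addmC mpolyXD; apply: PX.
Qed.

Lemma comp_mpolyX_mul (K : comNzRingType) (n k : nat)
    (s : n.-tuple {mpoly K[k]}) i p :
  ('X_i * p) \mPo s = tnth s i * (p \mPo s).
Proof. by rewrite rmorphM /= comp_mpolyXU -tnth_nth. Qed.

Section Polynomials.
Variable K : comNzRingType.

Lemma mderiv_mpolyX1 (n : nat) (i j : 'I_n) :
  mderiv i 'X_j = (j == i)%:R :> {mpoly K[n]}.
Proof.
rewrite mderivX mnm1E; case: eqVneq => [->|_]; last by rewrite scale0r.
by rewrite scale1r -[X in (X - _)%MM]add0m addmK mpolyX0.
Qed.

Lemma mderiv_comp (n k : nat) (s : n.-tuple {mpoly K[k]}) (j : 'I_k) p :
  mderiv j (p \mPo s)
  = \sum_(i < n) (mderiv i p \mPo s) * mderiv j (tnth s i).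
Proof.
elim/mpoly_alg_ind: p => [|p q IHp IHq|c p IH|i p IH].
- rewrite rmorph1 -!mpolyC1 mderivC big1 // => i _.
  by rewrite mderivC rmorph0 mul0r.
- rewrite rmorphD /= mderivD IHp IHq -big_split; apply: eq_bigr => i _.
  by rewrite mderivD rmorphD mulrDl.
- rewrite comp_mpolyZ mderivZ IH scaler_sumr; apply: eq_bigr => i _.
  by rewrite mderivZ comp_mpolyZ scalerAl.
- rewrite comp_mpolyX_mul mderivM IH.
  have -> : \sum_l (mderiv l ('X_i * p) \mPo s) * mderiv j (tnth s l) =
      \sum_l ((mderiv l 'X_i \mPo s) * (p \mPo s) * mderiv j (tnth s l)
        + tnth s i * ((mderiv l p \mPo s) * mderiv j (tnth s l))).
    apply: eq_bigr => l _; rewrite mderivM rmorphD /= comp_mpolyX_mul.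
    by rewrite rmorphM /= mulrDl -[X in _ + X]mulrA.
  rewrite big_split /= -mulr_sumr; congr (_ + _).
  rewrite (bigD1 i) //= big1 ?addr0 => [|l li].
    by rewrite mderiv_mpolyX1 eqxx rmorph1 mul1r mulrC.
  by rewrite mderiv_mpolyX1 eq_sym (negbTE li) rmorph0 !mul0r.
Qed.

Lemma comp_mpoly_sum (n k : nat) (s : n.-tuple {mpoly K[k]}) I (r : seq I) F :
  (\sum_(i <- r) F i) \mPo s = \sum_(i <- r) (F i \mPo s).
Proof. exact: (raddf_sum (comp_mpoly s)). Qed.

Lemma comp_mpolyA (n k l : nat) (s : n.-tuple {mpoly K[k]})
    (t : k.-tuple {mpoly K[l]}) p :
  (p \mPo s) \mPo t = p \mPo [tuple tnth s i \mPo t | i < n].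
Proof.
elim/mpoly_alg_ind: p => [|p q IHp IHq|c p IH|i p IH].
- by rewrite !rmorph1.
- by rewrite !rmorphD /= IHp IHq.
- by rewrite !comp_mpolyZ IH.
- by rewrite !comp_mpolyX_mul rmorphM /= IH tnth_mktuple.
Qed.

Lemma eq_comp_mpoly (n k : nat) (s t : n.-tuple {mpoly K[k]}) p :
  tnth s =1 tnth t -> p \mPo s = p \mPo t.
Proof. by move/eq_from_tnth ->. Qed.

Lemma msize_mderiv (n : nat) (i : 'I_n) (p : {mpoly K[n]}) :
  (msize (mderiv i p) <= (msize p).-1)%N.
Proof.
rewrite [X in (X <= _)%N]msizeE; apply/bigmax_leqP_seq => m + _.
rewrite mcoeff_msupp mcoeff_deriv => pm.
have /msize_mdeg_lt : (m + U_(i))%MM \in msupp p.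
  by rewrite mcoeff_msupp; apply: contraNneq pm => ->; rewrite mul0rn.
by rewrite mdegD mdeg1 addn1; case: (msize p).
Qed.

Lemma msize_sum_le (n : nat) I (r : seq I) (F : I -> {mpoly K[n]}) k :
  (forall i, (msize (F i) <= k)%N) -> (msize (\sum_(i <- r) F i) <= k)%N.
Proof.
move=> Fk; apply: (big_ind (fun p => msize p <= k)%N); rewrite ?msize0 //.
by move=> p q pk qk; rewrite (leq_trans (msizeD_le _ _)) // geq_max pk.
Qed.

End Polynomials.

(** [r] stands for derivatives of [p]: being of lower degree, it cannot cancel the leading part of
    [c *: p]. *)
Lemma scale_lowering_eq0 (K : idomainType) (n : nat) (c : K) (p r : {mpoly K[n]}) :
  (msize r <= (msize p).-1)%N -> c *: p + r = 0 -> (c == 0) || (p == 0).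
Proof.
move=> sr /eqP; rewrite addr_eq0 => /eqP e; apply/orP.
have [_|c0] := eqVneq c 0; [by left | right].
move: sr; rewrite -[r]opprK -e msizeN msizeZ //; apply: contraTT.
by rewrite -msize_poly_eq0; case: (msize p) => // k _; rewrite /= ltnn.
Qed.

Section Hat.
Variable K : comNzRingType.

(* [p(t_1 - t_0, ..., t_n - t_0)]; on linear forms [g . t] this is
   [- |g| t_0 + g . t]. *)
Definition hom_subst (n : nat) (p : {mpoly K[n]}) : {mpoly K[1 + n]} :=
  p \mPo [tuple 'X_(rshift 1 j) - 'X_ord0 | j < n].

Lemma hom_subst_linear n : linear (@hom_subst n).
Proof. by move=> c p q; rewrite /hom_subst comp_mpolyD comp_mpolyZ. Qed.

Lemma mderiv_hom_subst n (j : 'I_n) p :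
  mderiv (rshift 1 j) (hom_subst p) = hom_subst (mderiv j p).
Proof.
rewrite /hom_subst mderiv_comp (bigD1 j) //= big1 ?addr0 => [|i ij].
  rewrite tnth_mktuple mderivB !mderiv_mpolyX1 eqxx.
  by rewrite [_ == rshift 1 j]negbTE // subr0 mulr1.
rewrite tnth_mktuple mderivB !mderiv_mpolyX1 eq_rshift (negbTE ij).
by rewrite [_ == rshift 1 j]negbTE // subr0 mulr0.
Qed.

(** Translating all [t_j] by the same amount leaves the differences [t_j - t_0] unchanged. This
    yields the Euler equation of the row of ones of [rho_mx A]. *)
Lemma sum_mderiv_hom_subst n (p : {mpoly K[n]}) :
  \sum_(j < 1 + n) mderiv j (hom_subst p) = 0.
Proof.
rewrite /hom_subst; under eq_bigr do rewrite mderiv_comp.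
rewrite exchange_big /= big1 // => i _; rewrite -mulr_sumr tnth_mktuple.
under eq_bigr do rewrite mderivB !mderiv_mpolyX1.
have delta (i0 : 'I_(1 + n)) : \sum_j (i0 == j)%:R = 1 :> {mpoly K[1 + n]}.
  rewrite (bigD1 i0) //= eqxx big1 ?addr0 // => j ji.
  by rewrite eq_sym (negbTE ji).
by rewrite sumrB !delta subrr mulr0.
Qed.

(** Setting [t_0 = 0] in [hom_subst p] gives back [p]; the tuple [t] is this substitution. *)
Lemma hom_subst_eq0 n (p : {mpoly K[n]}) : hom_subst p = 0 -> p = 0.
Proof.
pose t : (1 + n).-tuple {mpoly K[n]} :=
  [tuple if fintype.split i is inr j then 'X_j else 0 | i < 1 + n].
move=> p0; have : hom_subst p \mPo t = 0 by rewrite p0 rmorph0.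
rewrite comp_mpolyA => <-; rewrite -[LHS]comp_mpoly_id.
apply: eq_comp_mpoly => i; rewrite !tnth_mktuple rmorphB /= !comp_mpolyXU.
rewrite -!tnth_nth !tnth_mktuple -[rshift 1 i]/(unsplit (inr i)) unsplitK.
have -> : ord0 = unsplit (inl ord0) :> 'I_(1 + n) by apply/val_inj.
by rewrite unsplitK subr0.
Qed.

End Hat.

Lemma msizeM_leq (K : idomainType) (n : nat) (p q : {mpoly K[n]}) :
  (msize (p * q) <= (msize p + msize q).-1)%N.
Proof.
have [->|p0] := eqVneq p 0; first by rewrite mul0r msize0.
have [->|q0] := eqVneq q 0; first by rewrite mulr0 msize0.
by rewrite msizeM.
Qed.

Lemma msize_comp_lin (K : idomainType) (n k : nat) (s : n.-tuple {mpoly K[k]}) p :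
  (forall i, (msize (tnth s i) <= 2)%N) -> (msize (p \mPo s) <= msize p)%N.
Proof.
move=> s2; rewrite comp_mpolyE; elim: (msupp p) (fun m => @msize_mdeg_lt _ _ p m).
  by rewrite big_nil msize0.
move=> m r IH pr; rewrite big_cons (leq_trans (msizeD_le _ _)) // geq_max.
rewrite IH ?andbT => [|m' m'r]; last by rewrite pr // inE m'r orbT.
rewrite (leq_trans (msizeZ_le _ _)) // (leq_trans _ (pr m _)) ?mem_head //.
rewrite mdegE; elim: (index_enum _) => [|i r' IH'].
  by rewrite !big_nil msize1.
rewrite !big_cons; apply: leq_trans (msizeM_leq _ _) _.
have : (msize (tnth s i ^+ m i) <= (m i).+1)%N.
  elim: (m i) => [|e IHe]; first by rewrite expr0 msize1.
  rewrite exprS; apply: leq_trans (msizeM_leq _ _) _.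
  by have := s2 i; move: (msize _) (msize _) IHe; lia.
by move: (msize _) (msize _) IH'; lia.
Qed.

Lemma msize_hom_subst (K : idomainType) (n : nat) (p : {mpoly K[n]}) :
  (msize (hom_subst p) <= msize p)%N.
Proof.
apply: msize_comp_lin => i; rewrite tnth_mktuple.
apply: leq_trans (msizeD_le _ _) _.
by rewrite msizeN !msizeX !mdeg1.
Qed.

(** * A basis of the integer kernel *)

Lemma columns_generate_mulmx1 (d n : nat) (A : 'M[int]_(d, n)) :
  columns_generate A -> exists B : 'M[int]_(n, d), A *m B = 1%:M.
Proof.
move=> gen; have [f fE] := choice (fun i : 'I_d => gen (delta_mx i 0)).
exists (\matrix_(j, i) f i j 0); apply/matrixP => k i.
have /matrixP/(_ k 0) := fE i; rewrite !mxE andbT => <-.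
by apply: eq_bigr => j _; rewrite mxE.
Qed.

(** Write [A = L *m D *m R] in Smith form, with [D = (D1 0)]. Surjectivity makes [D1] invertible
    over the integers, so the kernel is spanned by the last [m] columns of the inverse of [R]. They
    form [G], and the last [m] rows of [R] form [H]. *)
Lemma kernel_splitting (d n m : nat) (A : 'M[int]_(d, n)) :
  n = (d + m)%N -> columns_generate A ->
  exists (G : 'M[int]_(n, m)) (H : 'M[int]_(m, n)) (B : 'M[int]_(n, d)),
    [/\ A *m G = 0, H *m G = 1%:M & B *m A + G *m H = 1%:M].
Proof.
move=> nE /columns_generate_mulmx1; subst n => -[B0 AB0].
have [L uL [R uR [s _ AE]]] := int_Smith_normal_form A.
move: AE; set D := \matrix_(_, _) _ => AE.
have [D1 DE] : exists D1, D = row_mx D1 0.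
  exists (lsubmx D); rewrite -[LHS]hsubmxK; congr row_mx; apply/matrixP => i j.
  by rewrite !mxE /= ltn_eqF // ltn_addr.
pose G := invmx R *m col_mx 0 (1%:M : 'M_m).
pose H := row_mx 0 (1%:M : 'M_m) *m R.
have AG : A *m G = 0.
  rewrite AE /G mulmxA mulmxK // DE -mulmxA mul_row_col.
  by rewrite mulmx0 mul0mx addr0 mulmx0.
have HG : H *m G = 1%:M.
  by rewrite /H /G mulmxA mulmxK // mul_row_col mul0mx add0r mul1mx.
(* [A *m B0 = 1] exhibits the top block of [R *m B0] as a right inverse of the square matrix
   [L *m D1]. *)
have uD : D1 \in unitmx.
  have := AB0; rewrite AE DE -mulmxA -[R *m B0]vsubmxK -mulmxA.
  rewrite mul_row_col mul0mx addr0.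
  by rewrite mulmxA => /mulmx1_unit[+ _]; rewrite unitmx_mul => /andP[_ uD].
  
(* [G *m H] acts as the identity on the kernel of [A]. *)
have GHU p (U : 'M_(_, p)) : A *m U = 0 -> G *m (H *m U) = U.
  move=> /(congr1 (mulmx (invmx L))); rewrite mulmx0 AE -!mulmxA mulKmx //.
  rewrite DE -[R *m U]vsubmxK mul_row_col mul0mx addr0.
  move=> /(congr1 (mulmx (invmx D1))); rewrite mulmx0 mulKmx // => U0.
  rewrite /G /H -[R *m U]vsubmxK -?mulmxA U0 mul_row_col mul0mx add0r mul1mx.
  rewrite mul_col_mx mul0mx mul1mx.
  apply: etrans (mulKmx uR U); congr (_ *m _).
  by rewrite -[RHS]vsubmxK U0 col_mxKd.
(* The columns of [1 - B0 *m A] lie in the kernel, so [1 - G *m H] kills them; hence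
   [(1 - G *m H) *m B0 *m A = 1 - G *m H], which dictates [B]. *)
exists G, H, ((1%:M - G *m H) *m B0); split=> //.
have /GHU : A *m (1%:M - B0 *m A) = 0.
  by rewrite mulmxBr mulmx1 mulmxA AB0 mul1mx subrr.
rewrite mulmxA; set P := G *m H => e.
have : (1%:M - P) *m (1%:M - B0 *m A) = 0 by rewrite mulmxBl mul1mx e subrr.
rewrite mulmxBr mulmx1 mulmxA => /eqP; rewrite subr_eq0 => /eqP <-.
by rewrite subrK.
Qed.

Lemma ker_basis_of_splitting (d n m : nat) (A : 'M[int]_(d, n))
    (G : 'M[int]_(n, m)) (H : 'M[int]_(m, n)) (B : 'M[int]_(n, d)) :
  A *m G = 0 -> H *m G = 1%:M -> B *m A + G *m H = 1%:M -> ker_basis A G.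
Proof.
move=> AG HG BAGH; split=> // u Au; exists (H *m u); split.
  by rewrite -[LHS]mul1mx -BAGH mulmxDl -!mulmxA Au mulmx0 add0r.
by move=> c ->; rewrite mulmxA HG mul1mx.
Qed.

(** * Polynomials that are constant along the rows of the matrix *)

Lemma mderiv_eq0_exp (K : numFieldType) (n : nat) (i : 'I_n) (p : {mpoly K[n]}) m :
  mderiv i p = 0 -> m \in msupp p -> m i = 0%N.
Proof.
move=> /mpolyP/(_ (m - U_(i))%MM); rewrite mcoeff_deriv mcoeff0 mcoeff_msupp.
case: (posnP (m i)) => // mi; rewrite submK ?lep1mP -?lt0n // => /eqP.
by rewrite mulrn_eq0 /= => /eqP ->; rewrite eqxx.
Qed.

Lemma comp_mpoly_indep (K : numFieldType) (n k : nat)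
    (s t : n.-tuple {mpoly K[k]}) p :
  (forall i, mderiv i p = 0 \/ tnth s i = tnth t i) -> p \mPo s = p \mPo t.
Proof.
move=> st; rewrite !comp_mpolyE; apply: eq_big_seq => m mp; congr (_ *: _).
apply: eq_bigr => i _; have [dp|->//] := st i.
by rewrite (mderiv_eq0_exp dp mp) !expr0.
Qed.

(** The effect of [E_l] on the polynomial in the logarithms. Over a field of characteristic zero,
    its vanishing for all [l] characterizes the polynomials in the linear forms [g . t] with
    [A g = 0]. *)
Definition row_deriv (K : comNzRingType) (d n : nat) (A : 'M[int]_(d, n))
    (l : 'I_d) (p : {mpoly K[n]}) : {mpoly K[n]} :=
  \sum_(i < n) (A l i)%:~R *: mderiv i p.

Section RowInvariance.
Variables (K : numFieldType) (d n : nat) (A : 'M[int]_(d, n)).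

(** With fresh variables [y_l], the polynomial [p(t - A^T y)] has zero derivative in each [y_l], so
    it does not involve [y]; compare [y = r] with [y = 0]. *)
Lemma row_invariant (p : {mpoly K[n]}) (r : 'I_d -> {mpoly K[n]}) :
  (forall l, row_deriv A l p = 0) ->
  p \mPo [tuple 'X_i - \sum_(l < d) (A l i)%:~R *: r l | i < n] = p.
Proof.
move=> dp0.
pose s : n.-tuple {mpoly K[n + d]} := [tuple 'X_(lshift d i) -
  \sum_(l < d) (A l i)%:~R *: 'X_(rshift n l) | i < n].
pose P := p \mPo s.
have dP l : mderiv (rshift n l) P = 0.
  rewrite mderiv_comp; transitivity (- (row_deriv A l p \mPo s)); last first.
    by rewrite dp0 rmorph0 oppr0.
  rewrite /row_deriv comp_mpoly_sum -sumrN; apply: eq_bigr => i _ /=.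
  rewrite comp_mpolyZ tnth_mktuple mderivB mderiv_mpolyX1 eq_lrshift sub0r.
  rewrite (raddf_sum (mderiv (rshift n l))) (bigD1 l) //= big1 ?addr0 => [|k kl].
    by rewrite mderivZ mderiv_mpolyX1 eqxx mulrN -scalerAr mulr1.
  by rewrite mderivZ mderiv_mpolyX1 eq_rshift (negbTE kl) scaler0.
pose sub (f : 'I_d -> {mpoly K[n]}) : (n + d).-tuple {mpoly K[n]} :=
  [tuple match fintype.split k with inl i => 'X_i | inr l => f l end | k < n + d].
have PE f : P \mPo sub f
    = p \mPo [tuple 'X_i - \sum_(l < d) (A l i)%:~R *: f l | i < n].
  rewrite comp_mpolyA; apply: eq_comp_mpoly => i; rewrite !tnth_mktuple.
  rewrite rmorphB /= comp_mpolyXU -tnth_nth tnth_mktuple.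
  rewrite -[lshift d i]/(unsplit (inl i)) unsplitK; congr (_ - _).
  rewrite comp_mpoly_sum; apply: eq_bigr => l _ /=.
  rewrite comp_mpolyZ comp_mpolyXU -tnth_nth tnth_mktuple.
  by rewrite -[rshift n l]/(unsplit (inr l)) unsplitK.
rewrite -PE -[RHS]comp_mpoly_id.
have -> : P \mPo sub r = P \mPo sub (fun=> 0).
  apply: comp_mpoly_indep => k; case: (splitP k) => [i|l] ki.
    right; have -> : k = unsplit (inl i) by apply/val_inj.
    by rewrite !tnth_mktuple unsplitK.
  by left; have -> : k = rshift n l by apply/val_inj.
rewrite PE; apply: eq_comp_mpoly => i; rewrite !tnth_mktuple.
by rewrite big1 ?subr0 // => l _; rewrite scaler0.
Qed.

End RowInvariance.

Lemma hom_subst_linform (K : comNzRingType) (n : nat) (a : 'cV[int]_n) :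
  hom_subst (linform K a) = linform K (consv (- csum a) a).
Proof.
rewrite /hom_subst /linform comp_mpoly_sum big_split_ord /= big_ord1.
rewrite /consv col_mxEu mxE addrC rmorphN /= /csum rmorph_sum scaleNr scaler_suml /=.
rewrite -sumrB; apply: eq_bigr => i _.
rewrite comp_mpolyZ comp_mpolyXU -tnth_nth tnth_mktuple col_mxEd scalerBr.
by congr (_ - _ *: 'X_ _); apply/val_inj.
Qed.

Lemma linform_comp (K : comNzRingType) (n m k : nat) (G : 'M[int]_(n, m))
    (H : 'M[int]_(m, k)) (i : 'I_k) :
  linform K (col i H) \mPo [tuple linform K (col j G) | j < m]
  = linform K (col i (G *m H)).
Proof.
rewrite /linform comp_mpoly_sum /=.
under eq_bigr do rewrite comp_mpolyZ comp_mpolyXU -tnth_nth tnth_mktuple scaler_sumr.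
rewrite exchange_big; apply: eq_bigr => j _ /=.
rewrite !mxE rmorph_sum scaler_suml; apply: eq_bigr => l _ /=.
by rewrite !mxE scalerA rmorphM mulrC.
Qed.

(** Any value allowed by [hat_rel] is [hom_subst p], because the two substitutions agree on linear
    forms. A value exists: as [1 = B *m A + G *m H] and [p] is constant along the rows of [A],
    removing the [B *m A] part of the argument turns [p] into a polynomial in the forms of [G]. *)
Lemma hat_hom_subst (K : numFieldType) (d n : nat) (A : 'M[int]_(d, n))
    (p : {mpoly K[n]}) :
  columns_generate A -> (forall l, row_deriv A l p = 0) -> hat A p = hom_subst p.
Proof.
move=> genA dp0; apply: xget_unique; last first.
  move=> ph [G [q [_ -> ->]]]; rewrite /hom_subst comp_mpolyA.
  apply: eq_comp_mpoly => j; rewrite !tnth_mktuple.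
  by rewrite -hom_subst_linform.
(* The subtraction in [n - d] is truncated; [d <= n] follows from the right inverse of [A], read
   over the rationals. *)
have nE : n = (d + (n - d))%N.
  have [B] := columns_generate_mulmx1 genA.
  by move=> /(congr1 (map_mx (intr : int -> rat))); rewrite map_mxM map_mx1
    => /mulmx1_min dn; rewrite subnKC.
have [G [H [B [AG HG BAGH]]]] := kernel_splitting nE genA.
pose q := p \mPo [tuple linform K (col i H) | i < n].
have pE : p = q \mPo [tuple linform K (col j G) | j < n - d].
  rewrite /q comp_mpolyA -[LHS](row_invariant (fun l => linform K (col l B)) dp0).
  apply: eq_comp_mpoly => i; rewrite !tnth_mktuple linform_comp.
  apply/eqP; rewrite subr_eq; apply/eqP.
  transitivity (linform K (col i (G *m H + B *m A))).
    rewrite addrC BAGH /linform (bigD1 i) //= big1 ?addr0 => [|j ji].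
      by rewrite !mxE eqxx scale1r.
    by rewrite !mxE (negbTE ji) scale0r.
  rewrite /linform.
  under [X in _ = _ + X]eq_bigr do rewrite scaler_sumr.
  rewrite exchange_big -big_split; apply: eq_bigr => j _ /=.
  rewrite mxE [X in X%:~R]mxE rmorphD scalerDl; congr (_ + _).
    by rewrite [col i (G *m H) j 0]mxE.
  rewrite mxE rmorph_sum scaler_suml; apply: eq_bigr => l _ /=.
  by rewrite !mxE scalerA rmorphM mulrC.
exists G, q; split=> //; first exact: ker_basis_of_splitting AG HG BAGH.
rewrite pE /hom_subst comp_mpolyA; apply: eq_comp_mpoly => j.
by rewrite !tnth_mktuple -hom_subst_linform.
Qed.

(** * Integer powers of the derivation in the homogenizing variable *)

Section ShiftedDerivative.
Variables (K : numFieldType) (n : nat).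
Implicit Types (c : K) (p q : {mpoly K[1 + n]}) (k : int).

(* [\partial_0 (x_0^c x^s p(log x)) = x_0^(c - 1) x^s (dop c p)(log x)] *)
Definition dop c p := c *: p + mderiv ord0 p.

Lemma dop_linear c : linear (dop c).
Proof.
move=> a p q; rewrite /dop mderivD mderivZ !scalerDr !scalerA mulrC.
by rewrite addrACA.
Qed.

Lemma dop_inj c : c != 0 -> injective (dop c).
Proof.
move=> c0 p q e; apply/eqP; rewrite -subr_eq0.
have : dop c (p - q) = 0.
  by rewrite addrC -scaleN1r dop_linear scaleN1r e addNr.
by move/(scale_lowering_eq0 (msize_mderiv _ _)); rewrite (negbTE c0).
Qed.

(** The derivation lowers the degree, so [c + d/dt_0] is inverted by recursion on the size: start
    from [c^-1 p] and correct the error [c^-1 p']. *)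
Lemma dop_surj c p : c != 0 -> exists2 q, dop c q = p & (msize q <= msize p)%N.
Proof.
move=> c0; move: {2}(msize p) (leqnn (msize p)) => k.
elim: k p => [|k IH] p pk.
  exists 0; rewrite ?msize0 // /dop scaler0 mderiv0 addr0.
  by apply/esym/eqP; rewrite -msize_poly_eq0 -leqn0.
have [|q qE qs] := IH (- (c^-1 *: mderiv ord0 p)).
  rewrite msizeN (leq_trans (msizeZ_le _ _)) // (leq_trans (msize_mderiv _ _)) //.
  by move: (msize p) pk; lia.
exists (c^-1 *: p + q).
  rewrite /dop in qE *.
  rewrite scalerDr scalerA divff // scale1r mderivD mderivZ.
  by rewrite addrACA qE -addrA subrr addr0.
rewrite (leq_trans (msizeD_le _ _)) // geq_max msizeZ_le (leq_trans qs) //.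
rewrite msizeN (leq_trans (msizeZ_le _ _)) // (leq_trans (msize_mderiv _ _)) //.
exact: leq_pred.
Qed.

Definition dopV c p := xget 0 [set q | dop c q = p].

Lemma dopVK c : c != 0 -> cancel (dopV c) (dop c).
Proof.
move=> c0 p; have [q qE _] := dop_surj p c0.
exact: (@xgetI _ 0 [set q | dop c q = p] q).
Qed.

Lemma msize_dopV c p : c != 0 -> (msize (dopV c p) <= msize p)%N.
Proof.
move=> c0; have [q <- qs] := dop_surj p c0.
by rewrite (dop_inj c0 (dopVK c0 (dop c q))).
Qed.

Fixpoint dpow_pos c (k : nat) p :=
  if k is k'.+1 then dop (c - k'%:R) (dpow_pos c k' p) else p.

(** Integration raises the exponent [c + k'] to [c + k'.+1], and it is the operator at the raised
    exponent that has to be inverted. *)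
Fixpoint dpow_neg c (k : nat) p :=
  if k is k'.+1 then dopV (c + k'.+1%:R) (dpow_neg c k' p) else p.

(* [\partial_0^k (x_0^c x^s p(log x)) = x_0^(c - k) x^s (dpow c k p)(log x)] *)
Definition dpow c k p :=
  match k with Posz k => dpow_pos c k p | Negz k => dpow_neg c k.+1 p end.

Variable c : K.
Hypothesis cN : ~ is_integer c.

Lemma nonint_subr k : c - k%:~R != 0.
Proof. by apply/eqP => /eqP; rewrite subr_eq0 => /eqP ck; apply: cN; exists k. Qed.

Lemma nonint_addr (k : nat) : c + k%:R != 0.
Proof. by have := nonint_subr (- k%:Z); rewrite mulrNz opprK. Qed.

Lemma dpowS k p : dpow c (k + 1) p = dop (c - k%:~R) (dpow c k p).
Proof.
case: k => k; first by rewrite -PoszD addn1.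
rewrite NegzE mulrNz opprK; case: k => [|k].
  by rewrite addNr /= dopVK // nonint_addr.
have -> : - (k.+2 : int) + 1 = Negz k by rewrite NegzE; lia.
by rewrite /= dopVK // nonint_addr.
Qed.

(** The steps are invertible as [c] is no integer, so a two-sided sequence obeying the recursion is
    determined by its value at 0. Linearity of [dpow] and its commutation with derivatives follow
    without unfolding the choice in [dopV]. *)
Lemma dpow_unique (F : int -> {mpoly K[1 + n]}) :
  (forall k, F (k + 1) = dop (c - k%:~R) (F k)) ->
  forall k, F k = dpow c k (F 0).
Proof.
move=> FS; case; elim=> [|k IH] //.
- have -> : Posz k.+1 = Posz k + 1 by lia.
  by rewrite FS IH dpowS.
- apply: (dop_inj (nonint_subr (-1))); have := FS (-1).
  by rewrite addNr => <-; rewrite -(dpowS (-1)) addNr.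
- apply: (dop_inj (nonint_subr (Negz k.+1))).
  rewrite -FS -dpowS; have -> : Negz k.+1 + 1 = Negz k by rewrite !NegzE; lia.
  by [].
Qed.

Lemma dpow_linear k : linear (dpow c k).
Proof.
move=> a p q; apply/esym.
apply: (dpow_unique (F := fun k => a *: dpow c k p + dpow c k q)) => l.
by rewrite !dpowS dop_linear.
Qed.

Lemma dpow0 k : dpow c k 0 = 0.
Proof. exact: plin0 (dpow_linear k). Qed.

Lemma mderiv_dpow j k p : mderiv j (dpow c k p) = dpow c k (mderiv j p).
Proof.
apply: (dpow_unique (F := fun k => mderiv j (dpow c k p))) => l.
by rewrite dpowS /dop mderivD mderivZ mderiv_comm.
Qed.

Lemma msize_dpow k p : (msize (dpow c k p) <= msize p)%N.
Proof.
case: k; elim=> [|k IH] //=.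
- apply: leq_trans IH; rewrite (leq_trans (msizeD_le _ _)) // geq_max msizeZ_le.
  exact: leq_trans (msize_mderiv _ _) (leq_pred _).
- exact/msize_dopV/nonint_addr.
- exact: leq_trans (msize_dopV _ (nonint_addr _)) IH.
Qed.

End ShiftedDerivative.

(** * Vectors with a coordinate prepended for [x_0] *)

Variant ord_consv_spec n : 'I_(1 + n) -> Type :=
  | OrdHead : ord_consv_spec ord0
  | OrdTail (j : 'I_n) : ord_consv_spec (rshift 1 j).

Lemma ord_consvP n (i : 'I_(1 + n)) : ord_consv_spec i.
Proof.
case: (splitP i) => k ik.
  have -> : i = ord0 by apply/val_inj; rewrite /= ik [k]ord1.
  exact: OrdHead.
have -> : i = rshift 1 k by apply/val_inj.
exact: OrdTail.
Qed.

Section Consv.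
Variables (K : comNzRingType) (n : nat).
Implicit Types (c : K) (v : 'cV[K]_n) (s : 'cV[K]_(1 + n)).

Lemma consv0E c v : consv c v ord0 0 = c.
Proof.
have -> : ord0 = lshift n ord0 :> 'I_(1 + n) by apply/val_inj.
by rewrite /consv col_mxEu mxE.
Qed.

Lemma consvSE c v i : consv c v (rshift 1 i) 0 = v i 0.
Proof. exact: col_mxEd. Qed.

Lemma consv_dsubmx s : consv (s ord0 0) (dsubmx s) = s.
Proof.
apply/matrixP => i j; rewrite [j]ord1; case: (ord_consvP i) => [|k].
  by rewrite consv0E.
by rewrite consvSE mxE.
Qed.

Lemma dsubmx_consv c v : dsubmx (consv c v) = v.
Proof. exact: col_mxKd. Qed.

Lemma consv_inj c c' v v' : consv c v = consv c' v' -> c = c' /\ v = v'.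
Proof.
move=> e; split; first by rewrite -(consv0E c v) e consv0E.
by rewrite -(dsubmx_consv c v) e dsubmx_consv.
Qed.

Lemma consvD c c' v v' : consv c v + consv c' v' = consv (c + c') (v + v').
Proof.
by rewrite /consv add_col_mx; congr col_mx; apply/matrixP => i j; rewrite !mxE.
Qed.

Lemma unitv_ord0 : unitv K (ord0 : 'I_(1 + n)) = consv 1 (0 : 'cV[K]_n).
Proof.
rewrite -[LHS]consv_dsubmx unitvE eqxx; congr (consv _ _).
by apply/matrixP => i j; rewrite !mxE.
Qed.

Lemma unitv_rshift (j : 'I_n) : unitv K (rshift 1 j) = consv 0 (unitv K j).
Proof.
rewrite -[LHS]consv_dsubmx unitvE; congr (consv _ _).
by apply/matrixP => i k; rewrite !mxE eq_rshift.
Qed.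

Lemma consvN c v : - consv c v = consv (- c) (- v).
Proof.
by rewrite /consv opp_col_mx; congr col_mx; apply/matrixP => i j; rewrite !mxE.
Qed.

Lemma csumD v v' : csum (v + v') = csum v + csum v'.
Proof. by rewrite /csum -big_split; apply: eq_bigr => i _; rewrite mxE. Qed.

Lemma csum_unitv (j : 'I_n) : csum (unitv K j) = 1.
Proof.
rewrite /csum (bigD1 j) //= unitvE eqxx big1 ?addr0 // => i ij.
by rewrite unitvE eq_sym (negbTE ij).
Qed.

Lemma logseries_ext (f g : logseries K (1 + n)) :
  (forall c v, f (consv c v) = g (consv c v)) -> f = g.
Proof. by move=> fg; apply/funext => s; rewrite -[s](@consv_dsubmx s). Qed.

End Consv.

Lemma lterm_inj (K : comNzRingType) (n : nat) (s : 'cV[K]_n) : injective (lterm s).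
Proof. by move=> p q /(congr1 (@^~ s)); rewrite /lterm eqxx. Qed.

Lemma ddx0_powE (K : numFieldType) (n : nat) (k : int) (c : K) (s : 'cV[K]_n) p :
  ddx0_pow k (consv c s) p = lterm (consv (c - k%:~R) s) (dpow c k p).
Proof.
case: k => k.
  rewrite /ddx0_pow; elim: k => [|k IH]; first by rewrite subr0.
  rewrite iterS IH ddx_lterm consv0E unitv_ord0 consvN consvD oppr0 addr0.
  by rewrite intS rmorphD rmorph1 opprD addrA [c - 1 - _]addrAC.
(* Both sides choose from the same set of polynomials, because a term determines its polynomial. *)
have anti s' q : antideriv0 (s', q)
    = (s' + unitv K ord0, dopV ((s' + unitv K ord0) ord0 0) q).
  congr (_, xget _ _); apply/seteqP; split=> r /=; rewrite ddx_lterm addrK.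
    by move/lterm_inj.
  by move=> <-.
have -> : ddx0_pow (Negz k) (consv c s) p = 
    let sp := iter k.+1 (@antideriv0 K n) (consv c s, p) in lterm sp.1 sp.2 by [].
suff -> : iter k.+1 (@antideriv0 K n) (consv c s, p) =
    (consv (c + k.+1%:R) s, dpow_neg c k.+1 p) by rewrite NegzE mulrNz opprK.
elim: (k.+1) => [|j IH]; first by rewrite addr0.
by rewrite iterS IH anti unitv_ord0 consvD addr0 consv0E -addrA natr1.
Qed.

(** * The operators lifting series to one more variable *)

Section Lift.
Variables (K : numFieldType) (n : nat) (b c : K).
Hypothesis cN : ~ is_integer c.

Definition int_of (z : K) : int := xget 0 [set k : int | z = k%:~R].

Lemma int_ofK k : int_of k%:~R = k.
Proof. by apply: xget_unique => // l /= /intr_inj. Qed.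

(* For [phi] with exponents in [v + Z^n] and [c = b - |v|], this is
   [\sum_u \partial_0^(|u| + m) (x_0^c x^(v + u) hom_subst(p_u)(log x))], where
   [p_u] is the coefficient of [x^(v + u)] in [phi]. *)
Definition lift_series (m : nat) (phi : logseries K n) : logseries K (1 + n) :=
  fun s => if `[< is_integer (c - s ord0 0) >]
              && (s ord0 0 + csum (dsubmx s) == b - m%:R)
    then dpow c (int_of (c - s ord0 0)) (hom_subst (phi (dsubmx s))) else 0.

(** The coefficient at [x_0^a x^t] comes from the one at [a + 1], where the integer [c - a] has
    dropped by one; so [dpowS] applies, and the condition on the total exponent moves from [b - m]
    to [b - m.+1]. *)
Lemma ddx0_lift m phi : ddx ord0 (lift_series m phi) = lift_series m.+1 phi.
Proof.
apply: logseries_ext => a t.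
rewrite /ddx /lift_series unitv_ord0 consvD addr0 !consv0E !dsubmx_consv.
have -> : `[< is_integer (c - (a + 1)) >] = `[< is_integer (c - a) >].
  apply/asbool_equiv_eq; split=> -[k kE].
    by exists (k + 1); rewrite rmorphD /= -kE opprD addrA subrK.
  by exists (k - 1); rewrite rmorphB /= -kE opprD addrA.
have -> : (a + 1 + csum t == b - m%:R) = (a + csum t == b - m.+1%:R).
  by rewrite -[m.+1]addn1 natrD opprD addrA [RHS]eq_sym subr_eq eq_sym addrAC.
case: ifP => [/andP[/asboolP[k kE] _]|_]; last by rewrite scaler0 mderiv0 addr0.
have aE : a = c - k%:~R by rewrite -kE opprB addrC subrK.
have -> : c - (a + 1) = (k - 1)%:~R by rewrite rmorphB /= opprD addrA kE.
rewrite kE !int_ofK -{3}[k](subrK 1) dpowS //; congr (dop _ _).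
by rewrite rmorphB opprB aE addrCA addrC.
Qed.

(** The shift of [t] changes the total exponent but not the power of the derivation in [x_0]; [dpow]
    and [hom_subst] are linear and commute with the derivative in [t_j]. *)
Lemma ddx_lift m j phi :
  ddx (rshift 1 j) (lift_series m phi) = lift_series m.+1 (ddx j phi).
Proof.
apply: logseries_ext => a t.
rewrite {1}/ddx /lift_series unitv_rshift consvD addr0 !consv0E !dsubmx_consv.
have -> : (a + csum (t + unitv K j) == b - m%:R) = (a + csum t == b - m.+1%:R).
  rewrite csumD csum_unitv.
  by rewrite -[m.+1]addn1 natrD opprD !addrA [RHS]eq_sym subr_eq eq_sym.
case: ifP => _; last by rewrite scaler0 mderiv0 addr0.
rewrite consvSE mderiv_dpow // -dpow_linear // mderiv_hom_subst.
by rewrite -hom_subst_linear.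
Qed.

Lemma monop_lift m (a : 'X_{1..1 + n}) phi :
  monop (@ddx K (1 + n)) a (lift_series m phi)
  = lift_series (m + mdeg a)
      (monop (@ddx K n) [multinom a (rshift 1 j) | j < n] phi).
Proof.
have YY N := wr_YY (series_weyl_rel K N).
elim/mnm_ind: a => [|a i IH].
  rewrite mdeg0 addn0 monop0; congr lift_series.
  by rewrite -[LHS](monop0 (@ddx K n)); congr monop; apply/mnmP => j; rewrite !mnmE.
rewrite (monopU (YY _)) IH mdegD mdeg1 addnA addn1.
case: (ord_consvP i) => [|j].
  rewrite ddx0_lift; congr (lift_series _ (monop _ _ _)); apply/mnmP => j.
  by rewrite !(mnmDE, mnmE) addn0.
rewrite ddx_lift -(monopU (YY _)); congr (lift_series _ (monop _ _ _)).
by apply/mnmP => k; rewrite !(mnmDE, mnmE) eq_rshift.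
Qed.

End Lift.

(** * Solutions in terms of coefficients *)

Section PolyAction.
Variables (K : comNzRingType) (n : nat).
Implicit Types (f g : {mpoly K[n]}) (m : 'X_{1..n}) (phi : logseries K n).

(** The support varies with [f], so the sum is first rewritten over all monomials of bounded
    degree. *)
Lemma msupp_sum_linear (V : lmodType K) (F : 'X_{1..n} -> V) :
  linear (fun f => \sum_(m <- msupp f) f@_m *: F m).
Proof.
have E k f : (msize f <= k)%N -> \sum_(m <- msupp f) f@_m *: F m
    = \sum_(m : 'X_{1..n < k}) f@_m *: F m.
  pose I : subFinType _ := 'X_{1..n < k}.
  move=> fk; rewrite (big_mksub I) /=; first last.
  - by move=> x /msize_mdeg_lt/leq_trans/(_ fk).
  - by rewrite msupp_uniq.
  by rewrite big_rmcond //= => j /memN_msupp_eq0 ->; rewrite scale0r.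
move=> a f g; pose k := maxn (msize (a *: f + g)) (maxn (msize f) (msize g)).
have [k1 k2 k3] :
    [/\ (msize (a *: f + g) <= k)%N, (msize f <= k)%N & (msize g <= k)%N].
  by rewrite /k !leq_max !leqnn !orbT.
rewrite (E k _ k1) (E k _ k2) (E k _ k3) scaler_sumr -big_split /=.
by apply: eq_bigr => m _; rewrite mcoeffD mcoeffZ scalerA scalerDl.
Qed.

Definition poly_act f phi : logseries K n :=
  \sum_(m <- msupp f) f@_m *: monop (@ddx K n) m phi.

Lemma poly_act_linearl phi : linear (poly_act ^~ phi).
Proof. exact: msupp_sum_linear. Qed.

Lemma poly_actX m phi : poly_act 'X_[m] phi = monop (@ddx K n) m phi.
Proof. by rewrite /poly_act msuppX big_seq1 mcoeffX eqxx scale1r. Qed.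

Lemma poly_act_mulX i f phi : poly_act ('X_i * f) phi = ddx i (poly_act f phi).
Proof.
have XY := series_weyl_rel K n.
elim/mpolyind: f => [|a m f _ _ IH].
  by rewrite mulr0 (plin0 (poly_act_linearl phi)) (plin0 (wr_linY XY i)).
rewrite mulrDr -scalerAr -mpolyXD !poly_act_linearl !poly_actX IH.
by rewrite addmC (monopU (wr_YY XY)) (wr_linY XY).
Qed.

Lemma poly_actM f g phi : poly_act (f * g) phi = poly_act f (poly_act g phi).
Proof.
elim/mpoly_alg_ind: f => [|f1 f2 IH1 IH2|a f IH|i f IH].
- by rewrite mul1r -mpolyX0 poly_actX monop0.
- by rewrite mulrDl !(plinD (poly_act_linearl _)) IH1 IH2.
- by rewrite -scalerAl !(plinZ (poly_act_linearl _)) IH.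
- by rewrite -mulrA !poly_act_mulX IH.
Qed.

Lemma poly_act_linearr f : linear (poly_act f).
Proof.
move=> a x y; rewrite /poly_act scaler_sumr -big_split /=; apply: eq_bigr => m _.
rewrite monop_linear; last exact: wr_linY (series_weyl_rel K n).
by rewrite scalerDr !scalerA mulrC.
Qed.

Lemma poly_ann_left_ideal phi : left_ideal [set f | poly_act f phi = 0].
Proof.
split=> /= [|f g f0 g0|a f f0]; first exact: plin0 (poly_act_linearl phi).
  by rewrite (plinD (poly_act_linearl phi)) f0 g0 addr0.
by rewrite poly_actM f0 (plin0 (poly_act_linearr a)).
Qed.

Lemma lact_linearl phi : linear (fun P : weyl K n => lact P phi).
Proof. exact: wact_linearl. Qed.

Lemma lact1 phi : lact (1 : weyl K n) phi = phi.
Proof. exact: wact1. Qed.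

Lemma lact_wD i phi : lact (wD K i) phi = ddx i phi.
Proof.
have YY := wr_YY (series_weyl_rel K n).
rewrite /lact /wD wactX.
have -> : xdeg U_(rshift n i) = 0%MM.
  by apply/mnmP => j; rewrite !mnmE eq_rlshift.
have -> : ddeg U_(rshift n i) = (0 + U_(i))%MM.
  by apply/mnmP => j; rewrite !(mnmDE, mnmE) eq_rshift.
by rewrite monopU // !monop0.
Qed.

Lemma lact_wX i phi : lact (wX K i) phi = xmul i phi.
Proof.
have XX := wr_XX (series_weyl_rel K n).
rewrite /lact /wX wactX.
have -> : xdeg U_(lshift n i) = (0 + U_(i))%MM.
  by apply/mnmP => j; rewrite !(mnmDE, mnmE) eq_lshift.
have -> : ddeg U_(lshift n i) = 0%MM.
  by apply/mnmP => j; rewrite !mnmE eq_lrshift.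
by rewrite monopU // !monop0.
Qed.

Lemma lact_diffop f phi : lact (diffop f) phi = poly_act f phi.
Proof.
rewrite /diffop (plin_sum (lact_linearl phi)); apply: eq_bigr => m _.
(* Products over ['I_n] run through [index_enum], [monop] through [enum]; once the two lists are
   identified, one induction serves both. *)
congr (_ *: _); rewrite /monop; have <- : index_enum 'I_n = enum 'I_n.
  by rewrite enumT /index_enum; case: index_enum_key.
elim: (index_enum _) => [|i s IH].
  by rewrite big_nil lact1.
rewrite big_cons lactM IH /=; elim: (m i) => [|k IHk]; first by rewrite expr0 lact1.
by rewrite exprS lactM IHk lact_wD.
Qed.

End PolyAction.

Section EulerSolutions.
Variables (K : comNzRingType) (d n : nat).
Implicit Types (A : 'M[int]_(d, n)) (beta : 'cV[K]_d) (phi : logseries K n).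

Lemma logseries_sum I (r : seq I) (F : I -> logseries K n) s :
  (\sum_(i <- r) F i) s = \sum_(i <- r) F i s.
Proof. by elim: r => [|i r IH]; rewrite ?big_nil // !big_cons -IH. Qed.

(** Applying the j-th derivation and then multiplying by [x_j] preserves exponents, so the operator
    acts on each coefficient separately. *)
Lemma lact_euler A beta i phi s :
  lact (euler K A i - (beta i 0 *: (1 : weyl K n) : weyl K n)) phi s
  = ((map_mx intr A *m s) i 0 - beta i 0) *: phi s + row_deriv A i (phi s).
Proof.
rewrite addrC -scaleNr lact_linearl lact1 /euler (plin_sum (lact_linearl phi)).
rewrite [LHS]/(- beta i 0 *: phi s + (\sum_j _) s) logseries_sum mxE.
rewrite scalerDl scaler_suml.
rewrite addrAC addrC -big_split /=; congr (_ + _); apply: eq_bigr => j _.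
rewrite lactM lact_wX lact_wD mxE -scalerA -scalerDr.
by rewrite -[LHS]/((A i j)%:~R *: xmul j (ddx j phi) s) /xmul /ddx subrK.
Qed.

(** The operators annihilating [phi] form a left ideal, so the generators decide. *)
Lemma solution_euler_idealP A beta (I : set {mpoly K[n]}) phi :
  solution (euler_ideal A beta I) phi <->
  (forall f, I f -> poly_act f phi = 0) /\
  (forall i s, ((map_mx intr A *m s) i 0 - beta i 0) *: phi s
               + row_deriv A i (phi s) = 0).
Proof.
split=> [sol|[If Ei] P].
  split=> [f If|i s]; rewrite -?lact_diffop -?lact_euler.
    by apply: sol; apply: sub_gen_smallest; left; exists f.
  by rewrite sol //; apply: sub_gen_smallest; right; exists i.
apply: (smallest_sub (X := [set P | lact P phi = 0])).
  split=> /= [|f g f0 g0|a f f0]; first exact: plin0 (lact_linearl phi).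
    by rewrite (plinD (lact_linearl phi)) f0 g0 addr0.
  rewrite lactM f0; apply: (plin0 (wact_linearr _ a)).
  exact: series_weyl_rel.
move=> _ [[f /If f0 <-]|[i _ <-]] /=; first by rewrite lact_diffop.
by apply/funext => s; rewrite lact_euler Ei.
Qed.

Lemma toric_annP A phi :
  (forall f, toric_ideal K A f -> poly_act f phi = 0) <->
  (forall u v, A *m mnmv u = A *m mnmv v ->
     monop (@ddx K n) u phi = monop (@ddx K n) v phi).
Proof.
split=> [ann u v uv|eqm f].
  apply/eqP; rewrite -subr_eq0 -!poly_actX -scaleN1r addrC.
  rewrite -poly_act_linearl addrC scaleN1r; apply/eqP/ann.
  apply: sub_gen_smallest.
  by exists u, v.
apply: (smallest_sub (X := [set f | poly_act f phi = 0])).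
  exact: poly_ann_left_ideal.
move=> _ [u [v [uv ->]]] /=; rewrite addrC -scaleN1r poly_act_linearl.
by rewrite !poly_actX (eqm u v) // scaleN1r addNr.
Qed.

End EulerSolutions.

Lemma map_mx_int (k l : nat) (M : 'M[int]_(k, l)) : map_mx intr M = M.
Proof. by apply/matrixP => i j; rewrite mxE intz. Qed.

(** * The homogenized equations for the lifted series *)

Section LiftSolution.
Variables (K : numFieldType) (d n : nat).
Implicit Types (A : 'M[int]_(d, n)) (beta : 'cV[K]_d) (phi : logseries K n).

Lemma rho_mx_row0 A j : rho_mx A ord0 j = 1.
Proof.
have -> : ord0 = lshift d ord0 :> 'I_(1 + d) by apply/val_inj.
case: (ord_consvP j) => [|k]; last by rewrite /rho_mx block_mxEur mxE.
have -> : ord0 = lshift n ord0 :> 'I_(1 + n) by apply/val_inj.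
by rewrite /rho_mx block_mxEul mxE.
Qed.

Lemma rho_mx_col0 A i : rho_mx A (rshift 1 i) ord0 = 0.
Proof.
have -> : ord0 = lshift n ord0 :> 'I_(1 + n) by apply/val_inj.
by rewrite /rho_mx block_mxEdl mxE.
Qed.

Lemma rho_mx_rshift A i j : rho_mx A (rshift 1 i) (rshift 1 j) = A i j.
Proof. by rewrite /rho_mx block_mxEdr. Qed.

Lemma big_consv (V : nmodType) (F : 'I_(1 + n) -> V) :
  \sum_(i < 1 + n) F i = F ord0 + \sum_(i < n) F (rshift 1 i).
Proof.
rewrite big_split_ord /= big_ord1; congr (F _ + _); exact/val_inj.
Qed.

Lemma rho_mx_consv (T : comNzRingType) A (a : T) (t : 'cV[T]_n) :
  map_mx intr (rho_mx A) *m consv a t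
  = consv (a + csum t) (map_mx intr A *m t).
Proof.
apply/matrixP => i j; rewrite [j]ord1 mxE big_consv; case: (ord_consvP i) => [|k].
  rewrite !consv0E [map_mx intr _ _ _]mxE rho_mx_row0 mul1r; congr (_ + _).
  by apply: eq_bigr => l _; rewrite consvSE [map_mx intr _ _ _]mxE rho_mx_row0 mul1r.
rewrite !consvSE [map_mx intr _ _ _]mxE rho_mx_col0 mul0r add0r [RHS]mxE.
by apply: eq_bigr => l _; rewrite consvSE !mxE -rho_mx_rshift mxE.
Qed.

Lemma lift_solution A beta (b c : K) phi : ~ is_integer c ->
  solution (hypergeometric A beta) phi ->
  solution (hypergeometric (rho_mx A) (consv b beta)) (lift_series b c 0 phi).
Proof.
move=> cN /solution_euler_idealP[/toric_annP tor eul].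
apply/solution_euler_idealP; split.
  apply/toric_annP => u v uv.
  have mnmvE (m : 'X_{1..1 + n}) : mnmv m = consv (m ord0 : int)
      (mnmv [multinom m (rshift 1 j) | j < n]).
    apply/matrixP => i j; rewrite [j]ord1; case: (ord_consvP i) => [|k].
      by rewrite consv0E mxE.
    by rewrite consvSE !mxE mnmE.
  have csum_mnmv (m : 'X_{1..1 + n}) :
      (m ord0 : int) + csum (mnmv [multinom m (rshift 1 j) | j < n]) = mdeg m.
    rewrite mdegE big_consv PoszD; congr (_ + _).
    rewrite (big_morph Posz PoszD (erefl 0)); apply: eq_bigr => i _.
    by rewrite mxE mnmE.
  have := rho_mx_consv A; have := uv; rewrite !mnmvE => {}uv rhoE.
  (* The top row of [rho(A) u = rho(A) v] says that the total degrees agree, the other rows that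
     [A u' = A v']. *)
  have := rhoE int (u ord0 : int) (mnmv [multinom u (rshift 1 j) | j < n]).
  rewrite !map_mx_int uv -{1}[rho_mx A]map_mx_int rho_mx_consv !map_mx_int !csum_mnmv.
  move=> /consv_inj[[uvdeg] uvA].
  by rewrite !monop_lift // uvdeg (tor _ _ uvA).
move=> i s; rewrite -[s](@consv_dsubmx _ _ s).
move: (s ord0 0) (dsubmx _) => a t {s}.
rewrite rho_mx_consv /lift_series consv0E dsubmx_consv.
case: ifP => [/andP[_ /eqP at_b]|_]; last first.
  rewrite scaler0 add0r /row_deriv big1 // => j _.
  by rewrite mderiv0 scaler0.
have derivE j k p : mderiv j (dpow c k p) = dpow c k (mderiv j p).
  exact: mderiv_dpow.
have lin k := dpow_linear cN k (n := n).
set k := int_of _; set h := hom_subst _.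
case: (ord_consvP i) => [|l].
  (* Row of ones: the support condition makes the scalar factor vanish, and the sum of all
     derivatives kills the image of [hom_subst]. *)
  rewrite !consv0E at_b subr0 subrr scale0r add0r /row_deriv.
  under eq_bigr do rewrite rho_mx_row0 derivE.
  rewrite -(plin_sum (lin k)).
  under eq_bigr do rewrite scale1r.
  by rewrite sum_mderiv_hom_subst dpow0.
(* A row of [A]: its entry at [x_0] is zero, so [dpow] and [hom_subst] factor out and leave the
   Euler equation of [phi] at [t]. *)
rewrite !consvSE /row_deriv big_consv rho_mx_col0 scale0r add0r.
have -> : \sum_(j < n) (rho_mx A (rshift 1 l) (rshift 1 j))%:~R
      *: mderiv (rshift 1 j) (dpow c k h)
    = dpow c k (hom_subst (row_deriv A l (phi t))).
  rewrite /row_deriv (plin_sum (@hom_subst_linear _ _)) (plin_sum (lin k)).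
  apply: eq_bigr => j _.
  by rewrite rho_mx_rshift derivE /h mderiv_hom_subst.
by rewrite -lin /h -hom_subst_linear eul (plin0 (@hom_subst_linear _ _)) dpow0.
Qed.

End LiftSolution.

(** * Formal sums of terms with distinct exponents *)

Section FormalSum.
Variables (K : comNzRingType) (n m : nat) (C : set 'cV[int]_n).
Variables (f : 'cV[int]_n -> 'cV[K]_m) (q : 'cV[int]_n -> {mpoly K[m]}).
Hypothesis f_inj : injective f.

Lemma formal_sum_lterm u : C u ->
  formal_sum C (fun u => lterm (f u) (q u)) (f u) = q u.
Proof.
move=> Cu; rewrite /formal_sum -(fsbig_widen [set u]).
- by rewrite fsbig_set1 /lterm eqxx.
- by move=> x ->.
move=> x [_ /= xu]; rewrite /lterm; case: eqP => // /f_inj e.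
by case: xu.
Qed.

Lemma formal_sum_lterm0 s : (forall u, C u -> f u <> s) ->
  formal_sum C (fun u => lterm (f u) (q u)) s = 0.
Proof.
move=> Cs; rewrite /formal_sum fsbig1 // => u Cu; rewrite /lterm.
by case: eqP => // e; case: (Cs u Cu).
Qed.

Lemma formal_sum_ltermP s :
  (exists2 u, C u & f u = s /\ formal_sum C (fun u => lterm (f u) (q u)) s = q u) \/
  (forall u, C u -> f u <> s) /\ formal_sum C (fun u => lterm (f u) (q u)) s = 0.
Proof.
have [[u [Cu us]]|Cs] := pselect (exists u, C u /\ f u = s).
  by left; exists u => //; split=> //; rewrite -us formal_sum_lterm.
have {}Cs u : C u -> f u <> s by move=> Cu us; apply: Cs; exists u.
by right; split=> //; rewrite formal_sum_lterm0.
Qed.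

End FormalSum.

Lemma exponent_inj (K : numFieldType) (n : nat) (v : 'cV[K]_n) :
  injective (fun u => v + intv K u).
Proof.
move=> u u' /addrI /matrixP e; apply/matrixP => i j.
by have := e i j; rewrite !mxE => /intr_inj.
Qed.

(** * Weight cones *)

Section Cones.
Variable R : realType.

(** The cone is open, so it contains [w - e x] for some small [e > 0]; pairing with [x] gives
    [e (x . x) <= x . w <= 0]. *)
Lemma dual_cone_interior (n : nat) (W : set 'cV[R]_n) w x :
  sc_open_rational_cone W -> W w -> dual_cone W x -> dotv x w <= 0 -> x = 0.
Proof.
move=> [k [B [-> _]]] /=; set M := map_mx _ B => Mw xW xw.
(* [S] dominates every ratio [|(M x)_i| / (M w)_i], so [e = 1 / (1 + S)] keeps all defining
   inequalities strict. *)
pose S := \sum_(i < k) `|(M *m x) i 0| / (M *m w) i 0.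
have S0 : 0 <= S.
  by apply: sumr_ge0 => i _; rewrite divr_ge0 // ltW.
pose e := (1 + S)^-1.
have e0 : 0 < e by rewrite invr_gt0 ltr_wpDr.
have : 0 <= dotv x w - e * dotv x x.
  have -> : dotv x w - e * dotv x x = dotv x (w - e *: x).
    rewrite /dotv mulr_sumr -sumrB; apply: eq_bigr => j _.
    by rewrite !mxE mulrBr mulrCA.
  apply: xW => i /=; rewrite mulmxBr -scalemxAr.
  rewrite mxE [X in _ + X]mxE [X in _ - X]mxE subr_gt0.
  rewrite (le_lt_trans (ler_norm _)) // normrM gtr0_norm //.
  rewrite mulrC ltr_pdivrMr ?ltr_wpDr // -ltr_pdivrMl ?Mw //.
  rewrite mulrC /S (bigD1 i) //= addrA ltr_wpDr ?ltrDr //.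
  by apply: sumr_ge0 => j _; rewrite divr_ge0 // ltW.
have xx0 : 0 <= dotv x x by apply: sumr_ge0 => i _; rewrite -expr2 sqr_ge0.
rewrite subr_ge0 => le; have : dotv x x <= 0.
  by rewrite -(pmulr_rle0 _ e0) (le_trans le).
move=> xxle; have /eqP : dotv x x = 0 by apply/eqP; rewrite eq_le xxle.
rewrite psumr_eq0 => [/allP x0|i _]; last by rewrite -expr2 sqr_ge0.
apply/matrixP => i j; rewrite [j]ord1 mxE.
by have := x0 i (mem_index_enum _); rewrite /= mulf_eq0 orbb => /eqP.
Qed.

Lemma weight_cone_sub (d n : nat) (A : 'M[int]_(d, n)) (beta : 'cV[R[i]]_d)
    (w : 'cV[R]_n) (W W' : set 'cV[R]_n) :
  weight_cone A beta w W -> W' `<=` W -> sc_open_rational_cone W' -> W' w ->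
  weight_cone A beta w W'.
Proof.
move=> [_ _ pos ini] W'W W'cone W'w; split=> //.
  by case: pos => [|pos]; [left | right => w' /W'W; apply: pos].
by move=> w' /W'W; apply: ini.
Qed.

(** The map [y |-> (y_i - y_0)_i], adjoint to [u |-> (- |u|, u)]; cones of weights for [A] are
    pulled back along it. *)
Definition dehom_mx (T : nzRingType) (n : nat) : 'M[T]_(n, 1 + n) :=
  row_mx (const_mx (-1)) 1%:M.

Lemma dehom_mxE (T : comNzRingType) (n : nat) (y : 'cV[T]_(1 + n)) i :
  (dehom_mx T n *m y) i 0 = y (rshift 1 i) 0 - y ord0 0.
Proof.
rewrite mxE big_consv.
have -> : dehom_mx T n i ord0 = -1.
  have -> : ord0 = lshift n ord0 :> 'I_(1 + n) by apply/val_inj.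
  by rewrite row_mxEl mxE.
rewrite mulN1r addrC (bigD1 i) //= big1 ?addr0 => [|j ji].
  by rewrite row_mxEr mxE eqxx mul1r.
by rewrite row_mxEr mxE eq_sym (negbTE ji) mul0r.
Qed.

(** The inequalities of [W0] are stacked on those of [W] composed with [dehom_mx]. Strong convexity
    comes from [W0], while the pullback of [W] is stable under translation along the all-ones
    vector. *)
Lemma dehom_cone (n : nat) (W0 : set 'cV[R]_(1 + n)) (W : set 'cV[R]_n) :
  sc_open_rational_cone W0 -> sc_open_rational_cone W ->
  sc_open_rational_cone [set y | W0 y /\ W (dehom_mx R n *m y)].
Proof.
move=> [k0 [B0 [-> sc0]]] [k [B [-> _]]].
exists (k0 + k)%N, (col_mx B0 (B *m dehom_mx rat n)) => /=.
have mE y : map_mx ratr (col_mx B0 (B *m dehom_mx rat n)) *m y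
    = col_mx (map_mx (@ratr R) B0 *m y) (map_mx ratr B *m (dehom_mx R n *m y)).
  rewrite map_col_mx mul_col_mx map_mxM /= mulmxA; congr (col_mx _ (_ *m _ *m _)).
  by rewrite /dehom_mx map_row_mx map_mx1; congr row_mx; apply/matrixP => i j;
    rewrite !mxE rmorphN1.
split.
  apply/seteqP; split=> [y [y0 y1] i|y yi]; rewrite ?mE.
    by case: (splitP i) => l il; [have -> : i = lshift _ l by apply/val_inj|
      have -> : i = rshift _ l by apply/val_inj]; rewrite ?col_mxEu ?col_mxEd.
  split=> i.
    by have := yi (lshift _ i); rewrite mE col_mxEu.
  by have := yi (rshift _ i); rewrite mE col_mxEd.
move=> y yp yn; apply: sc0 => i.
  by have := yp (lshift _ i); rewrite mE col_mxEu.
by have := yn (lshift _ i); rewrite mE col_mxEu.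
Qed.

Lemma dotv_dehom (n : nat) (u : 'cV[int]_n) (y : 'cV[R]_(1 + n)) :
  dotv (intv R (consv (- csum u) u)) y = dotv (intv R u) (dehom_mx R n *m y).
Proof.
rewrite /dotv big_consv [intv R _ ord0 0]mxE consv0E rmorphN /= /csum rmorph_sum.
rewrite mulNr mulr_suml addrC -sumrB; apply: eq_bigr => i _.
by rewrite dehom_mxE mulrBr [intv R _ (rshift 1 i) 0]mxE consvSE [intv R u i 0]mxE.
Qed.

End Cones.

(** * Basic Nilsson solutions and their homogenization *)

Section Derivatives.
Variables (K : numFieldType) (n : nat).
Implicit Types (m : 'X_{1..n}) (phi psi : logseries K n) (s v : 'cV[K]_n).

Lemma intv_mnmvS m i : intv K (mnmv (m + U_(i))%MM) = intv K (mnmv m) + unitv K i.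
Proof.
by apply/matrixP => j k; rewrite [k]ord1 !mxE mnmDE mnm1E andbT PoszD rmorphD eq_sym.
Qed.

(** It lets [phi] be replaced by a single term, or by 0, when one coefficient of a derivative is
    computed. *)
Lemma monop_ddx_local m phi psi s :
  phi (s + intv K (mnmv m)) = psi (s + intv K (mnmv m)) ->
  monop (@ddx K n) m phi s = monop (@ddx K n) m psi s.
Proof.
have YY := wr_YY (series_weyl_rel K n).
elim/mnm_ind: m s => [|m i IH] s.
  have -> : mnmv (0%MM : 'X_{1..n}) = 0 by apply/matrixP => j k; rewrite !mxE mnm0E.
  by rewrite /intv map_mx0 addr0 !monop0.
rewrite intv_mnmvS addrA addrAC => e.
by rewrite !(monopU YY) /ddx (IH (s + unitv K i)).
Qed.

(** Each derivation multiplies the coefficient coming from [x^v] by an entry [s_i], and applies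
    [s_i + d/dt_i] to the one coming from [p]. The latter is injective unless [s_i = 0]; so if the
    polynomial dies, some factor [s_i] was 0 and the derivative of [x^v] dies as well. *)
Lemma monop_ddx_lterm v (p : {mpoly K[n]}) m : p != 0 ->
  monop (@ddx K n) m (lterm v p) (v - intv K (mnmv m)) = 0 ->
  monop (@ddx K n) m (lterm v 1) = 0.
Proof.
have YY := wr_YY (series_weyl_rel K n) => p0.
suff [q [a [-> -> qa]]] : exists q a,
    [/\ monop (@ddx K n) m (lterm v p) = lterm (v - intv K (mnmv m)) q,
        monop (@ddx K n) m (lterm v 1) = lterm (v - intv K (mnmv m)) a%:MP &
        q = 0 -> a = 0].
  rewrite {1}/lterm eqxx => /qa ->; apply/funext => s; rewrite /lterm mpolyC0.
  by case: ifP.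
elim/mnm_ind: m => [|m i [q [a [IHq IHa qa]]]].
  have -> : mnmv (0%MM : 'X_{1..n}) = 0 by apply/matrixP => j k; rewrite !mxE mnm0E.
  exists p, 1; rewrite /intv map_mx0 subr0 !monop0; split=> // /eqP.
  by rewrite (negbTE p0).
pose s := v - intv K (mnmv m).
exists (s i 0 *: q + mderiv i q), (s i 0 * a).
rewrite !(monopU YY) IHq IHa !ddx_lterm intv_mnmvS opprD addrA; split=> //.
  by rewrite mderivC addr0 -/s mpolyCM mul_mpolyC.
move/(scale_lowering_eq0 (msize_mderiv _ _))/orP=> [/eqP ->|/eqP /qa ->].
  by rewrite mul0r.
by rewrite mulr0.
Qed.

End Derivatives.

Section BasicNilsson.
Variables (R : realType) (d n : nat) (A : 'M[int]_(d, n)).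
Variables (beta : 'cV[R[i]]_d) (w : 'cV[R]_n).
Variables (v : 'cV[R[i]]_n) (C : set 'cV[int]_n).
Variable p : 'cV[int]_n -> {mpoly R[i][n]}.
Hypothesis bn : basic_nilsson A beta w v C p.

Let phi := nilsson_series v C p.

Lemma nilsson_seriesE u : C u -> phi (v + intv R[i] u) = p u.
Proof.
exact: (@formal_sum_lterm _ _ _ _ (fun u => v + intv R[i] u) _
  (@exponent_inj _ _ v)).
Qed.

Lemma nilsson_seriesP s :
  (exists2 u, C u & v + intv R[i] u = s /\ phi s = p u) \/
  (forall u, C u -> v + intv R[i] u <> s) /\ phi s = 0.
Proof.
exact: (@formal_sum_ltermP _ _ _ _ (fun u => v + intv R[i] u) _
  (@exponent_inj _ _ v)).
Qed.

(** As [A u = 0], the scalar in the Euler equation at [v + u] is that of [v]. The other term has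
    lower degree than [p u], so the two terms vanish separately. *)
Lemma basic_nilsson_row u l : C u ->
  row_deriv A l (p u) = 0 /\ (p u != 0 -> (map_mx intr A *m v) l 0 = beta l 0).
Proof.
move=> Cu; have [/solution_euler_idealP[_ eul] [W _ CW] _ _] := bn.
have [Au _] := CW u Cu.
have := eul l (v + intv R[i] u); rewrite -/phi nilsson_seriesE // mulmxDr.
have -> : map_mx intr A *m intv R[i] u = 0 by rewrite -map_mxM /= Au map_mx0.
rewrite addr0 => e; have := scale_lowering_eq0 _ e.
have -> : (msize (row_deriv A l (p u)) <= (msize (p u)).-1)%N.
  by apply: msize_sum_le => j; rewrite (leq_trans (msizeZ_le _ _)) // msize_mderiv.
move=> /(_ isT)/orP[/eqP c0|/eqP p0].
  move: e; rewrite c0 scale0r add0r => ->; split=> // _.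
  by apply/eqP; rewrite -subr_eq0 c0.
by move: e; rewrite p0 scaler0 add0r eqxx.
Qed.

(* The initial form of [phi] is its starting term [x^v p_0(log x)]. *)
Lemma fake_exponent_nilsson : fake_exponent A beta w v.
Proof.
have [/solution_euler_idealP[tor _] [W [Wcone Ww _ _] CW] _ [C0 p0]] := bn.
apply/solution_euler_idealP; split; last first.
  move=> i s; rewrite /lterm; case: eqVneq => [->|_]; last first.
    rewrite scaler0 add0r /row_deriv big1 // => j _.
    by rewrite mderiv0 scaler0.
  have [_ ->//] := basic_nilsson_row i C0; rewrite subrr scale0r add0r.
  by rewrite /row_deriv big1 // => j _; rewrite -mpolyC1 mderivC scaler0.
apply: (smallest_sub (X := [set f | poly_act f (lterm v 1) = 0])).
  exact: poly_ann_left_ideal.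
move=> _ [f [If _] <-] /=; rewrite /initial_form -big_filter.
rewrite (plin_sum (poly_act_linearl _)) big1_seq // => m /=.
rewrite mem_filter => /andP[/allP m_max mf]; rewrite poly_actX.
rewrite (monop_ddx_lterm p0) ?scaler0 //.
(* Take the coefficient of [x^(v - m)] in [f phi = 0]: only the monomial [m] of [f], applied to the
   starting term, contributes to it. *)
have /(congr1 (@^~ (v - intv R[i] (mnmv m)))) := tor f If.
rewrite /poly_act logseries_sum (bigD1_seq m) ?msupp_uniq //= big1_seq;
  last move=> m' /andP[m'm m'f].
  rewrite addr0 => /eqP; rewrite scaler_eq0 mcoeff_eq0 mf /= => /eqP.
  have : phi v = lterm v (p 0) v.
    by rewrite -{1}[v]addr0 -(map_mx0 intr) nilsson_seriesE // /lterm eqxx.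
  by rewrite -{1 3}[v](subrK (intv R[i] (mnmv m))) => /monop_ddx_local ->.
suff e : phi (v - intv R[i] (mnmv m) + intv R[i] (mnmv m')) = 0.
  rewrite -[LHS]/(f@_m' *: monop (@ddx _ n) m' phi _).
  rewrite (@monop_ddx_local _ _ _ _ 0) // (plin0 (monop_linear _ _)) ?scaler0 //.
  exact: wr_linY (series_weyl_rel _ n).
case: (nilsson_seriesP (v - intv R[i] (mnmv m) + intv R[i] (mnmv m'))) => [|[]//].
move=> [u Cu [uE _]]; case/eqP: m'm.
have {uE} uE : u = mnmv m' - mnmv m.
  apply: (@exponent_inj R[i] n v); rewrite uE /intv map_mxB.
  by rewrite addrA addrAC.
have [_ uW] := CW u Cu.
(* A second contributing monomial [m'] gives [u = m' - m] in the dual cone, and [u . w <= 0] because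
   [m] has maximal weight. *)
have u0 : intv R u = 0.
  apply: (dual_cone_interior Wcone Ww uW).
  have -> : dotv (intv R u) w = wtD w m' - wtD w m.
    rewrite /dotv /wtD -sumrB; apply: eq_bigr => i _.
    by rewrite uE !mxE rmorphB /= mulrBl ![_ * w i 0]mulrC.
  by rewrite subr_le0 m_max.
apply/mnmP => i; move/matrixP: u0 => /(_ i 0); rewrite uE !mxE.
by move/eqP; rewrite intr_eq0 subr_eq0 => /eqP[].
Qed.

End BasicNilsson.

(** * Homogenization of one basic solution *)

Section Homogenization.
Variables (R : realType) (d n : nat) (A : 'M[int]_(d, n)).
Variables (beta : 'cV[R[i]]_d) (w : 'cV[R]_n) (beta0 : R[i]).
Variables (v : 'cV[R[i]]_n) (C : set 'cV[int]_n).
Variable p : 'cV[int]_n -> {mpoly R[i][n]}.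
Hypotheses (A_gen : columns_generate A) (bn : basic_nilsson A beta w v C p).

Let c := beta0 - csum v.
Hypothesis cN : ~ is_integer c.

Let hom_exp (u : 'cV[int]_n) := consv (c - (csum u)%:~R) (v + intv R[i] u).
Let hom_coef (u : 'cV[int]_n) := dpow c (csum u) (hom_subst (p u)).

Let hom_exp_inj : injective hom_exp.
Proof. by move=> u u' /consv_inj[_ /exponent_inj]. Qed.

Let hat_coef u : C u -> hat A (p u) = hom_subst (p u).
Proof.
by move=> Cu; apply: hat_hom_subst => // l; case: (basic_nilsson_row bn l Cu).
Qed.

Lemma rho_seriesE : rho_series A beta0 v C p
  = formal_sum C (fun u => lterm (hom_exp u) (hom_coef u)).
Proof.
apply/funext => s; apply: eq_fsbigr => u /set_mem Cu.
by rewrite ddx0_powE hat_coef.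
Qed.

Lemma csum_intv (u : 'cV[int]_n) : csum (intv R[i] u) = (csum u)%:~R.
Proof. by rewrite /csum rmorph_sum; apply: eq_bigr => i _; rewrite mxE. Qed.

(** In the lift, a term with [t = v + u] must have [x_0]-exponent [c - |u|], since the total
    exponent is [beta0 = c + |v|]. So the two series have the same support conditions and
    coefficients. *)
Lemma rho_series_lift :
  rho_series A beta0 v C p = lift_series beta0 c 0 (nilsson_series v C p).
Proof.
rewrite rho_seriesE; apply: logseries_ext => a t.
rewrite /lift_series consv0E dsubmx_consv subr0.
case: (@formal_sum_ltermP _ _ _ C hom_exp hom_coef hom_exp_inj (consv a t)).
  move=> [u Cu [/consv_inj[<- <-] ->]]; rewrite opprB addrC subrK int_ofK.
  rewrite nilsson_seriesE //; case: ifP => // /negP[]; apply/andP.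
  split; first by apply/asboolP; exists (csum u).
  by rewrite csumD csum_intv /c; apply/eqP; ring.
move=> [Ca ->]; case: ifP => // /andP[_ /eqP at_b].
case: (nilsson_seriesP v C p t) => [[u Cu [ut _]]|[_ ->]]; last first.
  by rewrite (plin0 (@hom_subst_linear _ _)) dpow0.
case: (Ca u Cu); rewrite /hom_exp ut; congr consv.
by rewrite -csum_intv /c -at_b -ut csumD; ring.
Qed.

(** The expansion starts at [(beta0 - |v|, v)] and is indexed by the vectors [(- |u|, u)], [u] in
    [C], which lie in the kernel of [rho_mx A]. *)
Lemma rho_series_basic_nilsson :
  weight_vector (rho_mx A) (consv beta0 beta) (consv 0 w) ->
  is_basic_nilsson (rho_mx A) (consv beta0 beta) (consv 0 w)
    (rho_series A beta0 v C p).
Proof.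
move=> [W0 W0cone]; have [sol [W Wcone CW] [k pk] [C0 p0]] := bn.
pose g (u : 'cV[int]_n) : 'cV[int]_(1 + n) := consv (- csum u) u.
have gK u : dsubmx (g u) = u by apply: dsubmx_consv.
exists (consv c v), (g @` C), (fun u => hom_coef (dsubmx u)).
have rhoE : rho_series A beta0 v C p
    = nilsson_series (consv c v) (g @` C) (fun u => hom_coef (dsubmx u)).
  rewrite rho_seriesE; apply/funext => s.
  rewrite /nilsson_series /formal_sum fsbig_image; last first.
    by move=> u u' _ _ /consv_inj[].
  apply: eq_fsbigr => u _; rewrite gK /hom_exp; congr (lterm _ _ s).
  rewrite -[intv _ (g u)](@consv_dsubmx _ _) consvD mxE consv0E rmorphN /=.
  congr (consv _ (_ + _)).
  by rewrite -[in LHS](gK u); apply/matrixP => i j; rewrite !mxE.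
split=> //; split.
- by rewrite -rhoE rho_series_lift; apply: lift_solution.
(* [W0] supplies the constancy of the initial ideals; the pullback of [W] puts the vectors
   [(- |u|, u)] in the dual cone. *)
- exists [set y | W0 y /\ W (dehom_mx R n *m y)].
    have [W0sc W0w _ _] := W0cone; have [Wsc Ww _ _] := Wcone.
    apply: weight_cone_sub W0cone _ _ _.
    + by move=> y [].
    + exact: dehom_cone.
    + split=> //; suff -> : dehom_mx R n *m consv 0 w = w by [].
      by apply/matrixP => i j; rewrite [j]ord1 dehom_mxE consvSE consv0E subr0.
  move=> _ [u Cu <-]; have [Au uW] := CW u Cu; split.
    have := rho_mx_consv A (- csum u) u.
    rewrite !map_mx_int Au addNr => rg; apply: (etrans rg).
    by apply/matrixP => i j; rewrite !mxE; case: fintype.split => l; rewrite mxE.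
  by move=> y [_ Wy]; rewrite dotv_dehom; apply: uW.
- exists k => _ [u Cu <-]; rewrite gK.
  exact: leq_trans (msize_dpow cN _ _) (leq_trans (msize_hom_subst _) (pk u Cu)).
- split.
    exists 0 => //; rewrite /g /csum big1 => [|i _]; last by rewrite mxE.
    by apply/matrixP => i j; rewrite !mxE oppr0; case: fintype.split => l; rewrite mxE.
  (* At index 0 the derivation in [x_0] has power 0, so the starting coefficient is
     [hom_subst (p 0)], which is nonzero. *)
  have -> : dsubmx (0 : 'cV[int]_(1 + n)) = 0 by apply/matrixP => i j; rewrite !mxE.
  rewrite /hom_coef /csum big1 => [|i _]; last by rewrite mxE.
  by apply: contra_neq p0 => /hom_subst_eq0.
Qed.

End Homogenization.

(** * Bases and linear extension *)

Section Spans.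
Variables (K : fieldType) (V : lmodType K).
Implicit Types (S B : set V).

(** Combinations are lists of coefficients and indices, repetitions allowed, so that sums become
    concatenations. *)
Definition comb (I : Type) (f : I -> V) (s : seq (K * I)) : V :=
  \sum_(x <- s) x.1 *: f x.2.

Lemma comb_cat I (f : I -> V) s t :
  comb f (s ++ t) = comb f s + comb f t.
Proof. exact: big_cat. Qed.

Lemma comb_scale I (f : I -> V) a s :
  comb f [seq (a * x.1, x.2) | x <- s] = a *: comb f s.
Proof.
by rewrite /comb big_map scaler_sumr; apply: eq_bigr => x _; rewrite scalerA.
Qed.

Lemma lspanP S x :
  lspan S x <-> exists2 s, (forall y, y \in s -> S y.2) & x = comb id s.
Proof.
split=> [[k [c [f [Sf ->]]]]|[s Ss ->]].
  exists [seq (c i, f i) | i <- enum 'I_k].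
    by move=> _ /mapP[i _ ->]; apply: Sf.
  by rewrite /comb big_map big_enum.
exists (size s), (fun i => (tnth (in_tuple s) i).1),
  (fun i => (tnth (in_tuple s) i).2).
split; first by move=> i; apply: Ss; apply: mem_tnth.
by rewrite /comb (big_tnth _ _ s).
Qed.

Lemma lspan_linear S a x y : lspan S x -> lspan S y -> lspan S (a *: x + y).
Proof.
move=> /lspanP[s Ss ->] /lspanP[t St ->]; apply/lspanP.
exists ([seq (a * x.1, x.2) | x <- s] ++ t); last by rewrite comb_cat comb_scale.
by move=> z; rewrite mem_cat => /orP[/mapP[z' /Ss Sz ->]//|/St].
Qed.

Lemma lspan0 S : lspan S 0.
Proof. by apply/lspanP; exists [::]; rewrite // /comb big_nil. Qed.

Lemma sub_lspan S x : S x -> lspan S x.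
Proof.
move=> Sx; apply/lspanP; exists [:: (1, x)].
  by move=> y; rewrite inE => /eqP ->.
by rewrite /comb big_seq1 scale1r.
Qed.

Lemma lspan_comb S I (f : I -> V) s :
  (forall i, lspan S (f i)) -> lspan S (comb f s).
Proof.
move=> Sf; rewrite /comb; elim: s => [|x s IH].
  by rewrite big_nil; apply: lspan0.
by rewrite big_cons; apply: lspan_linear.
Qed.

Lemma lspan_min S S' : (forall x, S x -> lspan S' x) -> lspan S `<=` lspan S'.
Proof.
move=> SS' x /lspanP[s Ss ->].
elim: s Ss => [_|y s IH Ss]; first by rewrite /comb big_nil; apply: lspan0.
rewrite /comb big_cons; apply: lspan_linear; first by apply/SS'/Ss/mem_head.
by apply: IH => z zs; apply: Ss; rewrite inE zs orbT.
Qed.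

Lemma lspan_rangeP I (f : I -> V) x : lspan (range f) x <-> exists s, x = comb f s.
Proof.
split=> [/lspanP[s Ss ->]|[s ->]]; last first.
  by apply: lspan_comb => i; apply: sub_lspan; exists i.
elim: s Ss => [_|y s IH Ss]; first by exists [::]; rewrite /comb !big_nil.
have [t tE] : exists t, comb id s = comb f t.
  by apply: IH => z zs; apply: Ss; rewrite inE zs orbT.
have [i _ fi] := Ss y (mem_head _ _).
by exists ((y.1, i) :: t); rewrite [LHS]big_cons [RHS]big_cons /= fi; congr (_ + _).
Qed.

End Spans.

(** * Existence of bases and extension by linearity *)

Section Bases.
Variables (K : fieldType) (V : lmodType K).
Implicit Types (S B : set V).

Definition linearly_free B : Prop := forall (s : seq V) (c : V -> K),
  uniq s -> (forall x, x \in s -> B x) -> \sum_(x <- s) c x *: x = 0 ->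
  forall x, x \in s -> c x = 0.

(** For the chain condition of Zorn's lemma: a linear relation involves finitely many vectors, and
    these all lie in one member of the chain. *)
Lemma total_on_seq (T : eqType) (F : set (set T)) (s : seq T) :
  total_on F subset -> s != [::] -> (forall x, x \in s -> (\bigcup_(X in F) X) x) ->
  exists2 X, F X & forall x, x \in s -> X x.
Proof.
move=> Ftot; case: s => // x s _; elim: s x => [|y s IH] x Fs.
  by have [X FX Xx] := Fs x (mem_head _ _); exists X => // z; rewrite inE => /eqP ->.
have [X FX Xx] := Fs x (mem_head _ _).
have [|Y FY Ys] := IH y; first by move=> z zs; apply: Fs; rewrite inE zs orbT.
have [XY|YX] := Ftot X Y FX FY.
  by exists Y => // z; rewrite inE => /orP[/eqP ->|/Ys//]; apply: XY.
by exists X => // z; rewrite inE => /orP[/eqP ->//|/Ys/YX].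
Qed.

(** A maximal free subset [B] of [S] spans, for a vector of [S] outside the span of [B] could be
    added to it. *)
Lemma exists_basis S :
  exists (I : choiceType) (f : I -> V), (forall i, S (f i)) /\ is_basis (lspan S) f.
Proof.
have [B [[BS Bfree] Bmax]] : exists B, (B `<=` S /\ linearly_free B) /\
    forall B', B `<` B' -> ~ (B' `<=` S /\ linearly_free B').
  apply: (@Zorn_bigcup _ [set B | B `<=` S /\ linearly_free B]) => F FP Ftot.
  split=> [x [X /FP[XS _] /XS//]|s c us sF s0 x xs].
  have [||X /FP[_ Xfree] sX] := @total_on_seq _ F s Ftot; last 1 first.
  - exact: Xfree s0 x xs.
  - by case: s xs {us sF s0}.
  - exact: sF.
have SB : lspan S `<=` lspan B.
  apply: lspan_min => x Sx; apply: contrapT => xB.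
  have nBx : ~ B x by move=> /sub_lspan.
  apply: (Bmax (B `|` [set x])).
    split; first by left.
    by move/(_ x (or_intror erefl)).
  split=> [y [/BS//|->//]|s c us sBx s0].
  have sB y : y \in s -> y != x -> B y by move=> /sBx[//|->]; rewrite eqxx.
  have [xs|xs] := boolP (x \in s); last first.
    by apply: Bfree s0 => // y ys; apply: sB => //; apply: contraNneq xs => <-.
  have rB y : y \in rem x s -> B y.
    by rewrite mem_rem_uniq // inE => /andP[yx ys]; apply: sB.
  move: s0; rewrite (perm_big _ (perm_to_rem xs)) big_cons /= => s0.
  (* A nonzero coefficient would put [x] in the span of [B]. *)
  have cx : c x = 0.
    apply: contrapT => /eqP cx; apply: xB.
    have -> : x = - (c x)^-1 *: (\sum_(y <- rem x s) c y *: y).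
      move/eqP: s0; rewrite addrC addr_eq0 => /eqP ->.
      by rewrite scaleNr scalerN opprK scalerA mulVf // scale1r.
    apply/lspanP; exists [seq (- (c x)^-1 * c y, y) | y <- rem x s].
      by move=> _ /mapP[y /rB yB ->].
    by rewrite /comb big_map scaler_sumr; apply: eq_bigr => y _; rewrite scalerA.
  move: s0; rewrite cx scale0r add0r => s0 y ys.
  have [->//|yx] := eqVneq y x.
  apply: (Bfree _ _ (rem_uniq x us) rB s0).
  by rewrite mem_rem_uniq // inE yx.
exists (set_type B), val; split=> [[x /set_mem/BS//]|].
have rangeB : range (val : set_type B -> V) = B.
  apply/seteqP; split=> [_ [[x xB] _ <-]|x xB]; first exact: set_mem.
  by exists (exist _ x (mem_set xB)).
split=> [|s c us s0 i si].
  rewrite rangeB; apply/seteqP; split=> //.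
  by apply: lspan_min => x /BS; apply: sub_lspan.
(* [c] lives on the subtype, while freeness of [B] takes coefficients on all of [V]: extend by 0. *)
pose c' x := oapp c 0 (insub x : option (set_type B)).
have c'E j : c' (val j) = c j by rewrite /c' valK.
rewrite -c'E; apply: (Bfree (map val s)).
- by rewrite map_inj_uniq //; apply: val_inj.
- by move=> _ /mapP[[x xB] _ ->]; apply: set_mem.
- by rewrite big_map -[RHS]s0; apply: eq_bigr => j _; rewrite c'E.
- exact: map_f.
Qed.

(** Gathering equal indices gives a combination with distinct ones, whose coefficients vanish by
    freeness. This makes the linear extension well defined. *)
Lemma comb_eq0 (W : lmodType K) U (I : choiceType) (f : I -> V) (r : I -> W) s :
  is_basis U f -> comb f s = 0 -> comb r s = 0.
Proof.
move=> [_ f_free] s0; pose t := undup (map snd s).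
pose c j := \sum_(x <- s) (if x.2 == j then x.1 else 0).
have combE (Z : lmodType K) (h : I -> Z) : comb h s = \sum_(j <- t) c j *: h j.
  under eq_bigr do rewrite scaler_suml.
  rewrite exchange_big; apply: eq_big_seq => x xs.
  rewrite (bigD1_seq x.2) ?undup_uniq ?mem_undup ?map_f //= eqxx big1 ?addr0 //.
  by move=> j jx; rewrite eq_sym (negbTE jx) scale0r.
rewrite combE big1_seq // => j /= jt.
by rewrite (f_free t c (undup_uniq _)) ?scale0r // -combE.
Qed.

Lemma linear_extension (W : lmodType K) U (I : choiceType) (f : I -> V) (r : I -> W) :
  is_basis U f ->
  exists T : V -> W, [/\ forall x, U x -> lspan (range r) (T x),
    linear_on U T, forall i, T (f i) = r i &
    forall T' : V -> W, linear_on U T' -> (forall i, T' (f i) = r i) ->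
      forall x, U x -> T' x = T x].
Proof.
move=> fbasis; have [UE _] := fbasis.
have comb_uniq s t : comb f s = comb f t -> comb r s = comb r t.
  move=> e; apply/eqP; rewrite -subr_eq0 addrC -scaleN1r -comb_scale -comb_cat.
  apply/eqP/(comb_eq0 _ fbasis).
  by rewrite comb_cat comb_scale e scaleN1r addNr.
(* [T] reads its value off some expansion of [x] in the basis, and is 0 where there is none; by
   [comb_uniq] the expansion does not matter. *)
pose T x := xget 0 [set y | exists s, x = comb f s /\ y = comb r s].
have TE s : T (comb f s) = comb r s.
  apply: xget_unique; first by exists s.
  by move=> _ [t [/comb_uniq st ->]].
have comb1 (Z : lmodType K) (h : I -> Z) i : h i = comb h [:: (1, i)].
  by rewrite /comb big_seq1 scale1r.
have UP x : U x <-> exists s, x = comb f s by rewrite -UE; apply: lspan_rangeP.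
have Uf i : U (f i) by apply/UP; exists [:: (1, i)].
exists T; split=> [x /UP[s ->]|a x y /UP[s ->] /UP[t ->]|i|T' lT' T'f x /UP[s ->]].
- by rewrite TE; apply/lspan_rangeP; exists s.
- by rewrite -comb_scale -comb_cat !TE comb_cat comb_scale.
- by rewrite [f i]comb1 TE -comb1.
rewrite TE; elim: s => [|y s IH].
  have U0 : U 0 by apply/UP; exists [::]; rewrite /comb big_nil.
  (* Linearity on [U] with the scalar -1 at the vector 0 gives [T' 0 = 0]. *)
  have := lT' (-1) 0 0 U0 U0; rewrite scaler0 addr0 scaleN1r addNr.
  by rewrite /comb !big_nil.
rewrite /comb !big_cons lT' ?T'f //; last by apply/UP; exists s.
by congr (_ + _).
Qed.

End Bases.

(** * The homogenization map on the Nilsson space *)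

Theorem proposition3p17 (R : realType) (d n : nat) (A : 'M[int]_(d, n))
    (beta : 'cV[R[i]]_d) (w : 'cV[R]_n) (beta0 : R[i])
    (A_gen : columns_generate A)
    (w_weight : weight_vector A beta w)
    (w0_weight : weight_vector (rho_mx A) (consv beta0 beta) (consv 0 w))
    (beta0_hom : homogenizing_value A beta w beta0) :
  (forall v C p, basic_nilsson A beta w v C p ->
     is_basic_nilsson (rho_mx A) (consv beta0 beta) (consv 0 w)
       (rho_series A beta0 v C p)) /\
  (exists (I : choiceType) v C p, @nilsson_basis R d n A beta w I v C p) /\
  (forall (I : choiceType) v C p, @nilsson_basis R d n A beta w I v C p ->
     exists T : logseries R[i] n -> logseries R[i] (1 + n),
       [/\ forall phi, nilsson_space A beta w phi ->
             nilsson_space (rho_mx A) (consv beta0 beta) (consv 0 w) (T phi),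
           linear_on (nilsson_space A beta w) T,
           forall i, T (nilsson_series (v i) (C i) (p i)) =
             rho_series A beta0 (v i) (C i) (p i) &
           forall T' : logseries R[i] n -> logseries R[i] (1 + n),
             linear_on (nilsson_space A beta w) T' ->
             (forall i, T' (nilsson_series (v i) (C i) (p i)) =
               rho_series A beta0 (v i) (C i) (p i)) ->
             forall phi, nilsson_space A beta w phi -> T' phi = T phi]).
Proof.
have rhoP v C p : basic_nilsson A beta w v C p ->
    is_basic_nilsson (rho_mx A) (consv beta0 beta) (consv 0 w)
      (rho_series A beta0 v C p).
  move=> bn; apply: (rho_series_basic_nilsson A_gen bn) w0_weight.
  by case: beta0_hom => _; apply; apply: fake_exponent_nilsson bn.
split=> //; split.
  have [I [f [fbn fbasis]]] := exists_basis (is_basic_nilsson A beta w).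
  (* An exponent, an index set and coefficients are chosen for each basis element, since
     [rho_series] depends on the expansion. *)
  have [e eE] := choice fbn; have [e' e'E] := choice eE; have [e'' e''E] := choice e'E.
  exists I, e, e', e''; split=> [i|]; first by case: (e''E i).
  suff <- : f = fun i => nilsson_series (e i) (e' i) (e'' i) by [].
  by apply/funext => i; case: (e''E i).
move=> I v C p [bn basis].
have [T [Tspan Tlin TE Tuniq]] :=
  linear_extension (fun i => rho_series A beta0 (v i) (C i) (p i)) basis.
exists T; split=> // phi /Tspan; apply: lspan_min => _ [i _ <-].
exact/sub_lspan/rhoP.
Qed.
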